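(* Let $N\in\mathbb N$, $\Theta=\mathbb R^N$, and let $\pi(\mathrm d\theta)\propto\exp\{-U(\theta)\}\,\mathrm d\theta$ be any prior on $\Theta$ with $U$ of class $C^2(\Theta)$ and strongly convex. Then, for the finite-dimensional logistic-Gaussian model on $\mathbb X=[0,1]$ with densities (with respect to the Lebesgue measure on $[0,1]$) $$f(x\,|\,\theta)=\frac{e^{\theta\cdot\Gamma_N(x)}}{\int_0^1e^{\theta\cdot\Gamma_N(y)}\,\mathrm dy},\qquad x\in[0,1],\ \theta\in\mathbb R^N,\qquad\Gamma_N(x)=(\sin\pi x,\sin2\pi x,\dots,\sin N\pi x),$$ and for any fixed $\theta_0\in\Theta$, the PCR $\epsilon_n$ at $\theta_0$ satisfies $$\epsilon_n=O\big(n^{-1/2}\big)\qquad\text{as }n\to+\infty.$$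
   Context: $\xi_1,\xi_2,\dots$ are i.i.d. with density $f(\cdot\,|\,\theta_0)$ on $[0,1]$. The posterior is $\pi_n(\mathrm d\theta\,|\,x_1,\dots,x_n)=\prod_{i=1}^nf(x_i|\theta)\,\pi(\mathrm d\theta)\big/\int_\Theta\prod_{i=1}^nf(x_i|\tau)\,\pi(\mathrm d\tau)$. A sequence $\epsilon_n>0$ is a posterior contraction rate (PCR) at $\theta_0$ if $\pi_n(\{\theta:|\theta-\theta_0|\ge M_n\epsilon_n\}\,|\,\xi_1,\dots,\xi_n)\to0$ in probability for every sequence of positive numbers $M_n\to\infty$; the PCR considered is $\epsilon_n=\mathbb E[\mathcal W_2(\pi_n(\cdot\,|\,\xi_1,\dots,\xi_n);\delta_{\theta_0})]=\mathbb E\big[\big(\int_\Theta|\theta-\theta_0|^2\,\pi_n(\mathrm d\theta\,|\,\xi_1,\dots,\xi_n)\big)^{1/2}\big]$, with $\mathcal W_2$ the 2-Wasserstein distance. *)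

(* Defs.v *)
From HB Require Import structures.
From mathcomp Require Import all_boot all_order all_algebra.
From mathcomp Require Import finmap.
From mathcomp Require Import all_classical all_reals all_analysis.

Set Implicit Arguments.
Unset Strict Implicit.
Unset Printing Implicit Defensive.

Import Order.TTheory GRing.Theory Num.Theory.
Import numFieldNormedType.Exports.

Local Open Scope classical_set_scope.
Local Open Scope ring_scope.

(* 'rV[R]_n carries the product sigma-algebra, i.e. the one generated by the
   coordinate maps (the Borel sigma-algebra of R^n), as n.-tuple R does in the
   library. *)
Definition measure_rV_display : measure_display -> measure_display.
Proof. exact. Qed.

Section measurable_rV.
Context {R : realType}.
Variable n : nat.

Let coords : 'I_n -> 'rV[R]_n -> R := fun i v => v ord0 i.

Let rV_set0 : g_sigma_preimage coords set0.
Proof. exact: sigma_algebra0. Qed.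

Let rV_setC A : g_sigma_preimage coords A -> g_sigma_preimage coords (~` A).
Proof. exact: sigma_algebraC. Qed.

Let rV_bigcup (F : (set 'rV[R]_n)^nat) :
  (forall i, g_sigma_preimage coords (F i)) ->
  g_sigma_preimage coords (\bigcup_i (F i)).
Proof. exact: sigma_algebra_bigcup. Qed.

HB.instance Definition _ :=
  @isMeasurable.Build (measure_rV_display default_measure_display)
  'rV[R]_n (g_sigma_preimage coords) rV_set0 rV_setC rV_bigcup.

End measurable_rV.

Section measurable_rV_theory.
Context {R : realType}.

Lemma measurable_coord_rV n (i : 'I_n) :
  measurable_fun [set: 'rV[R]_n] (fun v : 'rV[R]_n => v ord0 i).
Proof.
move=> _ Y mY; rewrite setTI; apply: sub_sigma_algebra => /=.
rewrite -bigcup_seq/=; exists i => /=; first by rewrite mem_index_enum.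
by exists Y => //; rewrite setTI.
Qed.

Lemma measurable_fun_rVP d (T : measurableType d) n (f : T -> 'rV[R]_n) :
  measurable_fun [set: T] f <->
  forall i, measurable_fun [set: T] (fun x => f x ord0 i).
Proof.
split=> [mf i|mf].
  exact: (measurableT_comp (@measurable_coord_rV n i) mf).
move=> _ A mA; rewrite setTI; move: A mA.
apply: smallest_sub.
  split=> [|A|F] /=.
  - by rewrite preimage_set0.
  - by rewrite setTD preimage_setC => ?; exact: measurableC.
  - by move=> mF; rewrite preimage_bigcup; exact: bigcup_measurable.
move=> A; rewrite -bigcup_seq/= => -[i _ [B mB <-]].
by rewrite setTI -comp_preimage -[X in measurable X]setTI; exact: mf.
Qed.

Definition cons_rV n (p : R * 'rV[R]_n) : 'rV[R]_n.+1 :=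
  \row_i (if unlift ord0 i is Some j then p.2 ord0 j else p.1).

Lemma cons_rV0 n p : @cons_rV n p ord0 ord0 = p.1.
Proof. by rewrite mxE unlift_none. Qed.

Lemma cons_rVS n p (j : 'I_n) : @cons_rV n p ord0 (lift ord0 j) = p.2 ord0 j.
Proof. by rewrite mxE liftK. Qed.

Lemma measurable_cons_rV n : measurable_fun setT (@cons_rV n).
Proof.
apply/measurable_fun_rVP => i; case: (unliftP ord0 i) => [j ->|->].
- under eq_fun do rewrite cons_rVS.
  exact: (measurableT_comp (@measurable_coord_rV n j) measurable_snd).
- by under eq_fun do rewrite cons_rV0; exact: measurable_fst.
Qed.

Definition split_rV n (v : 'rV[R]_n.+1) : R * 'rV[R]_n :=
  (v ord0 ord0, \row_j v ord0 (lift ord0 j)).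

Lemma measurable_split_rV n : measurable_fun setT (@split_rV n).
Proof.
apply/measurable_fun_pairP; split; first exact: measurable_coord_rV.
apply/measurable_fun_rVP => i; under eq_fun do rewrite /= mxE.
exact: measurable_coord_rV.
Qed.

Lemma cons_rVK n : cancel (@cons_rV n) (@split_rV n).
Proof.
move=> p; rewrite /split_rV cons_rV0 [RHS]surjective_pairing; congr pair.
by apply/rowP => j; rewrite mxE cons_rVS.
Qed.

(* Lebesgue measure on R^n, as the n-fold product of the one-dimensional one. *)
Fixpoint lebesgue_rV (n : nat) : set 'rV[R]_n -> \bar R :=
  match n with
  | 0 => dirac (0 : 'rV[R]_0)
  | m.+1 => pushforward (lebesgue_measure \x @lebesgue_rV m)%E (@cons_rV m)
  end.

Let lebesgue_rV_measure n :
  {m : {sigma_finite_measure set 'rV[R]_n -> \bar R} |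
    m = @lebesgue_rV n :> (set 'rV[R]_n -> \bar R)}.
Proof.
elim: n => [|n [m mE]]; first by exists (dirac (0 : 'rV[R]_0)).
pose p : {measure set _ -> \bar R} := (@lebesgue_measure R \x m)%E.
have pfin : sigma_finite setT p.
  have /sigma_finiteP[F [TF ndF Foo]] := sigma_finiteT (@lebesgue_measure R).
  have /sigma_finiteP[G [TG ndG Goo]] := sigma_finiteT m.
  exists (fun k => F k `*` G k).
    rewrite -setXTT TF TG predeqE => -[x y]; split.
      move=> [/= [i _ Fx] [j _ Gy]]; exists (maxn i j) => //; split.
      - by move: x Fx; exact/subsetPset/ndF/leq_maxl.
      - by move: y Gy; exact/subsetPset/ndG/leq_maxr.
    by move=> [i _ []/= ? ?]; split; exists i.
  move=> k; have [? ?] := Foo k; have [? ?] := Goo k.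
  split; first exact: measurableX.
  by rewrite /p/= product_measure1E// lte_mul_pinfty// ge0_fin_numE.
pose q : {measure set 'rV[R]_n.+1 -> \bar R} :=
  measure_function_pushforward__canonical__measure_function_Measure p
    (@measurable_cons_rV n).
have qfin : sigma_finite setT q.
  have [F FT Foo] := pfin.
  exists (fun k => @split_rV n @^-1` F k).
    by rewrite -preimage_bigcup -FT preimage_setT.
  move=> k; have [mF Fk] := Foo k; split.
    by rewrite -[X in measurable X]setTI; exact: measurable_split_rV.
  rewrite /q /= /pushforward -comp_preimage.
  suff -> : @split_rV n \o @cons_rV n = id by [].
  by apply/funext => x /=; exact: cons_rVK.
pose mix := @Measure_isSigmaFinite.Build _ _ _ (q : set _ -> \bar R) qfin.
exists (HB.pack_for {sigma_finite_measure set 'rV[R]_n.+1 -> \bar R}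
  (q : set _ -> \bar R) (Measure.class q) mix).
by rewrite /= /pushforward /p mE.
Qed.

Let lebesgue_rV0 n : @lebesgue_rV n set0 = 0%E.
Proof. by have [m <-] := lebesgue_rV_measure n. Qed.

Let lebesgue_rV_ge0 n (A : set 'rV[R]_n) : (0 <= lebesgue_rV A)%E.
Proof. by have [m <-] := lebesgue_rV_measure n. Qed.

Let lebesgue_rV_sigma_additive n : semi_sigma_additive (@lebesgue_rV n).
Proof.
by have [m <-] := lebesgue_rV_measure n; exact: measure_semi_sigma_additive.
Qed.

HB.instance Definition _ n := isMeasure.Build _ _ _ (@lebesgue_rV n)
  (lebesgue_rV0 n) (@lebesgue_rV_ge0 n) (@lebesgue_rV_sigma_additive n).

Let lebesgue_rV_sigma_finite n : sigma_finite setT (@lebesgue_rV n).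
Proof. by have [m <-] := lebesgue_rV_measure n; exact: sigma_finiteT. Qed.

HB.instance Definition _ n := Measure_isSigmaFinite.Build _ _ _
  (@lebesgue_rV n) (@lebesgue_rV_sigma_finite n).

End measurable_rV_theory.
Arguments lebesgue_rV {R n}.

Section euclidean.
Context {R : realType} {n : nat}.

Definition dotv (u v : 'rV[R]_n) : R := \sum_i u ord0 i * v ord0 i.

(* The library's norm `|_| on 'rV[R]_n is the sup norm. *)
Definition eucl_norm (u : 'rV[R]_n) : R := Num.sqrt (dotv u u).

Definition partial (i : 'I_n) (f : 'rV[R]_n -> R) : 'rV[R]_n -> R :=
  'D_(delta_mx ord0 i) f.

Definition class_C1 (f : 'rV[R]_n -> R) : Prop :=
  [/\ continuous f,
      (forall i x, derivable f x (delta_mx ord0 i)) &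
      forall i, continuous (partial i f)].

Definition class_C2 (f : 'rV[R]_n -> R) : Prop :=
  class_C1 f /\ forall i, class_C1 (partial i f).

Definition strongly_convex (f : 'rV[R]_n -> R) : Prop :=
  exists2 m : R, 0 < m & forall (x y : 'rV[R]_n) (t : R), 0 <= t <= 1 ->
    f (t *: x + (1 - t) *: y) <=
    t * f x + (1 - t) * f y - m / 2 * t * (1 - t) * eucl_norm (x - y) ^+ 2.

End euclidean.

Section wasserstein.
Local Open Scope ereal_scope.
Context {R : realType} {n : nat}.

(* mu and nu are bare set functions so that the posterior below need not be
   packaged as a probability; a coupling itself is a genuine probability. *)
Definition couplings (mu nu : set 'rV[R]_n -> \bar R) :
    set (probability ('rV[R]_n * 'rV[R]_n)%type R) :=
  [set g | forall A, measurable A ->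
    g (A `*` setT) = mu A /\ g (setT `*` A) = nu A].

Definition wasserstein2 (mu nu : set 'rV[R]_n -> \bar R) : \bar R :=
  sqrte (ereal_inf
    [set \int[g]_z ((eucl_norm (z.1 - z.2)) ^+ 2)%:E | g in couplings mu nu]).

End wasserstein.

Section logistic_gaussian.
Context {R : realType} {N : nat}.

(* (sin (pi x), sin (2 pi x), ..., sin (N pi x)), with 0-based index k *)
Definition sine_features (x : R) : 'rV[R]_N :=
  \row_(k < N) sin (k.+1%:R * pi * x).

Definition lg_density (theta : 'rV[R]_N) (x : R) : R :=
  expR (dotv theta (sine_features x)) /
  \int[lebesgue_measure]_(y in `[0, 1]) expR (dotv theta (sine_features y)).

Definition has_density_propto_exp (prior : probability 'rV[R]_N R)
    (U : 'rV[R]_N -> R) : Prop :=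
  exists2 c : R, 0 < c & forall A, measurable A ->
    prior A = (c%:E * \int[lebesgue_rV]_(theta in A) (expR (- U theta))%:E)%E.

Definition likelihood (xs : seq R) (theta : 'rV[R]_N) : R :=
  \prod_(x <- xs) lg_density theta x.

Definition posterior (prior : probability 'rV[R]_N R) (xs : seq R) :
    set 'rV[R]_N -> \bar R :=
  fun A => (\int[prior]_(theta in A) (likelihood xs theta)%:E /
            \int[prior]_tau (likelihood xs tau)%:E)%E.

End logistic_gaussian.

Section sampling.
Context {R : realType} {N : nat} {d : measure_display}.
Context {Omega : measurableType d} (P : probability Omega R).

Definition mutually_independent (xi : nat -> {RV P >-> R}) : Prop :=
  forall (J : {fset nat}) (B : nat -> set R),
    (forall i, measurable (B i)) ->
    P (\bigcap_(i in [set` J]) xi i @^-1` B i) =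
    (\prod_(i <- J) P (xi i @^-1` B i))%E.

Definition iid_lg (theta0 : 'rV[R]_N) (xi : nat -> {RV P >-> R}) : Prop :=
  mutually_independent xi /\
  forall i A, measurable A ->
    distribution P (xi i) A =
    (\int[lebesgue_measure]_(x in A `&` `[0%R, 1%R]) (lg_density theta0 x)%:E)%E.

(* the posterior given the first n observations; the sample is 0-indexed *)
Definition posterior_at (prior : probability 'rV[R]_N R)
    (xi : nat -> {RV P >-> R}) (n : nat) (w : Omega) :
    set 'rV[R]_N -> \bar R :=
  posterior prior [seq xi i w | i <- iota 0 n].

Definition is_PCR (prior : probability 'rV[R]_N R) (xi : nat -> {RV P >-> R})
    (theta0 : 'rV[R]_N) (eps : R^nat) : Prop :=
  (forall n, (0 < n)%N -> 0 < eps n) /\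
  forall M : R^nat, (forall n, 0 < M n) -> M @ \oo --> +oo ->
    forall delta : R, 0 < delta ->
      P [set w | (delta%:E <= posterior_at prior xi n w
          [set theta | (M n * eps n <= eucl_norm (theta - theta0))%R])%E]
        @[n --> \oo] --> 0%E.

(* E[W_2(posterior given the first n observations; dirac at theta0)] *)
Definition wasserstein_rate (prior : probability 'rV[R]_N R)
    (xi : nat -> {RV P >-> R}) (theta0 : 'rV[R]_N) (n : nat) : \bar R :=
  (\int[P]_w wasserstein2 (posterior_at prior xi n w) (dirac theta0))%E.

End sampling.

(* Main.v *)
(* Write h = theta - theta0, mu for the mean of the features under theta0, B(h)
   for the logarithm of the moment generating function of the centred features
   Gamma - mu, and G for the sum of Gamma(xi_i) - mu over the sample.  Then the
   likelihood ratio at theta0 + h is exp(h . G - n B(h)), where B is convex,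
   vanishes at 0 and satisfies B(h) >= c min(|h|^2, |h|): the density is bounded
   below and the sines are linearly independent of the constants.

   The substitution h -> 2 h replaces integrations by parts and lower bounds on
   the normalizing constant.  By convexity, the unnormalized posterior density p
   satisfies p(2 h) <= p(h) (p(h) / p(0)), so that for every r the integral of
   |h|^2 p(h) over |h| > r is at most 2^(N + 2) times the integral of p times the
   supremum over |u| > r / 2 of |u|^2 p(u) / p(0).  With A = |G| + O(1), taking
   r of order A / n bounds the posterior second moment by O(A^2 / n^2 + 1 / n)
   on the event A <= n c / 2, and taking r of order A (only the strong convexity
   of U is used) bounds it by O(A^2 + 1) in general.  Hence W_2 is at most
   O(n^(-1/2) (1 + (A / sqrt n)^4)), and A / sqrt n has a bounded fourth moment
   because its exponential moments factor over the independent sample.  The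
   contraction property is Markov's inequality applied to W_2. *)

(* The rate is an expectation, so a bound valid with probability tending to one is not enough: the
   second moment must be controlled for every sample, by an integrable quantity. The likelihood
   alone does not give this. The features are bounded, so B grows at most linearly; hence the
   minimum in its lower bound, and hence the condition A <= n c / 2, under which n B(h) still
   dominates h . G far from the origin. Without that condition, only the Gaussian factor exp(- m
   |h|^2) coming from the prior is left, and it yields a bound with no decay in n. But then A / sqrt
   n exceeds c sqrt n / 2, and each power of this ratio inserted into the bound gains a power of
   n^(-1/2). Three of them turn A / sqrt n into its fourth power, an even one, which is why fourth
   moments appear.

   Comparing p(2 h) with p(h)^2 / p(0) suits this plan because the same integral of p stands on both
   sides and cancels in the posterior, whatever the sample is. The O(1) term in A is the slope L of
   a linear lower bound of U at theta0. *)
Require Import Defs.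
From HB Require Import structures.
From mathcomp Require Import all_boot all_order all_algebra.
From mathcomp Require Import finmap ring lra.
From mathcomp Require Import all_classical all_reals all_analysis.
From mathcomp Require Import measurable_realfun.
Import Order.TTheory GRing.Theory Num.Theory.
Import numFieldNormedType.Exports.
Local Open Scope classical_set_scope.
Local Open Scope ring_scope.

Set Implicit Arguments.
Unset Strict Implicit.
Unset Printing Implicit Defensive.

(** * Integration against densities and image measures *)

Section transfer.
Local Open Scope ereal_scope.
Import HBNNSimple.

Lemma measurable_preimageT d1 d2 (X : measurableType d1) (T : measurableType d2)
  (g : X -> T) (A : set T) :
  measurable_fun setT g -> measurable A -> measurable (g @^-1` A).
Proof. by move=> mg mA; rewrite -(setTI (_ @^-1` _)); exact: mg. Qed.

(** Monotone convergence along simple functions composed with [g]. The right-hand side sees [nu],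
    [g] and [w] only through the weights of preimages under [g], so two triples with equal weights
    integrate every [f] alike. *)
Lemma integral_density_lim d1 d2 (X : measurableType d1)
  (T : measurableType d2) (R : realType) (nu : {measure set X -> \bar R})
  (g : X -> T) (w : X -> R) (f : T -> \bar R) (h : {nnsfun T >-> R}^nat) :
  measurable_fun setT g -> measurable_fun setT w -> (forall x, (0 <= w x)%R) ->
  nondecreasing_seq (h : (T -> R)^nat) ->
  (forall t, EFin \o h^~ t @ \oo --> f t) ->
  \int[nu]_x (f (g x) * (w x)%:E) =
  limn (fun n => \sum_(y \in range (h n))
    (y%:E * \int[nu]_(x in g @^-1` (h n @^-1` [set y])) (w x)%:E)).
Proof.
move=> mg mw w0 ndh hf.
have mhg n : measurable_fun setT (fun x => h n (g x)).
  by apply: measurableT_comp.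
transitivity (limn (fun n => \int[nu]_x ((h n (g x))%:E * (w x)%:E))).
  rewrite -monotone_convergence//=.
  - apply: eq_integral => x _; apply/esym/cvg_lim => //.
    by apply: cvgeZr => //; exact: hf.
  - by move=> n; apply/measurable_EFinP; exact: measurable_funM.
  - by move=> n x _; rewrite mule_ge0// lee_fin.
  - by move=> x _ a b ab; rewrite lee_wpmul2r ?lee_fin//; exact/lefP/ndh.
congr (limn _); apply/funext => n.
transitivity (\int[nu]_x (\sum_(y \in range (h n))
    (y%:E * ((\1_(h n @^-1` [set y]) (g x))%:E * (w x)%:E)))).
  apply: eq_integral => x _; rewrite (fimfunE (h n)) -fsumEFin//.
  rewrite ge0_mule_fsuml => [|y]; last exact: nnfun_muleindic_ge0.
  by apply: eq_fsbigr => y _; rewrite EFinM muleA.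
have mA y : measurable (g @^-1` (h n @^-1` [set y])).
  exact: measurable_preimageT.
have mind y : measurable_fun setT (fun x => (\1_(h n @^-1` [set y]) (g x))%:E * (w x)%:E).
  apply/measurable_EFinP/measurable_funM => //.
  by apply: measurableT_comp.
rewrite ge0_integral_fsum//; last 2 first.
- by move=> y; exact: measurable_funeM.
- move=> y x _; rewrite muleA; apply: mule_ge0; last by rewrite lee_fin.
  exact: (nnfun_muleindic_ge0 (h n) y (g x)).
apply: eq_fsbigr => y; rewrite inE => -[t _ <-].
rewrite ge0_integralZl ?lee_fin//; last first.
  by move=> x _; rewrite mule_ge0// lee_fin.
congr (_ * _); rewrite [RHS]integral_mkcond; apply: eq_integral => x _.
rewrite patchE indicE; case: ifPn => [/set_mem/= xA|xA].
  by rewrite mem_set// mul1e.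
by rewrite memNset ?mul0e// => xA'; move/negP: xA; apply; exact: mem_set.
Qed.

(* Covers at once a density with respect to a measure, an image measure and a
   marginal. *)
Lemma eq_integral_transfer d1 d2 d3 (X1 : measurableType d1)
  (X2 : measurableType d2) (T : measurableType d3) (R : realType)
  (nu1 : {measure set X1 -> \bar R}) (nu2 : {measure set X2 -> \bar R})
  (g1 : X1 -> T) (g2 : X2 -> T) (w1 : X1 -> R) (w2 : X2 -> R) (f : T -> \bar R) :
  measurable_fun setT g1 -> measurable_fun setT g2 ->
  measurable_fun setT w1 -> measurable_fun setT w2 ->
  (forall x, (0 <= w1 x)%R) -> (forall x, (0 <= w2 x)%R) ->
  (forall A, measurable A -> \int[nu1]_(x in g1 @^-1` A) (w1 x)%:E =
                             \int[nu2]_(x in g2 @^-1` A) (w2 x)%:E) ->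
  measurable_fun setT f -> (forall t, 0 <= f t) ->
  \int[nu1]_x (f (g1 x) * (w1 x)%:E) = \int[nu2]_x (f (g2 x) * (w2 x)%:E).
Proof.
move=> mg1 mg2 mw1 mw2 w10 w20 nu12 mf f0.
pose h := nnsfun_approx measurableT mf.
have ndh : nondecreasing_seq (h : (T -> R)^nat) by exact: nd_nnsfun_approx.
have hf t : EFin \o h^~ t @ \oo --> f t by exact: cvg_nnsfun_approx.
rewrite (@integral_density_lim _ _ _ _ _ nu1 g1 w1 f h)//.
rewrite (@integral_density_lim _ _ _ _ _ nu2 g2 w2 f h)//.
congr (limn _); apply/funext => n; apply: eq_fsbigr => y _.
by rewrite nu12.
Qed.

Lemma eq_integral_density d1 d2 (T : measurableType d1) (X : measurableType d2)
  (R : realType) (mu : {measure set T -> \bar R}) (nu : {measure set X -> \bar R})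
  (g : X -> T) (w : X -> R) (f : T -> \bar R) :
  measurable_fun setT g -> measurable_fun setT w -> (forall x, (0 <= w x)%R) ->
  (forall A, measurable A -> mu A = \int[nu]_(x in g @^-1` A) (w x)%:E) ->
  measurable_fun setT f -> (forall t, 0 <= f t) ->
  \int[mu]_t f t = \int[nu]_x (f (g x) * (w x)%:E).
Proof.
move=> mg mw w0 munu mf f0.
rewrite -(@eq_integral_transfer _ _ _ _ _ _ _ mu nu id g (cst 1%R) w f)//.
  by apply: eq_integral => x _; rewrite mule1.
by move=> A mA /=; rewrite integral_cst// mul1e munu.
Qed.

End transfer.

(** * The dilation by two and Lebesgue measure *)

Section lebesgue_doubling.
Context {R : realType}.
Local Open Scope ereal_scope.

Lemma integral_lebesgue_rVS n (F : 'rV[R]_n.+1 -> \bar R) :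
  measurable_fun setT F -> (forall v, 0 <= F v) ->
  \int[lebesgue_rV]_v F v =
  \int[lebesgue_measure]_x \int[lebesgue_rV]_v F (cons_rV (x, v)).
Proof.
move=> mF F0.
have mcons := @measurable_cons_rV R n.
rewrite (eq_measure_integral (pushforward
  (@lebesgue_measure R \x @lebesgue_rV R n) (@cons_rV R n)))//.
rewrite ge0_integral_pushforward// preimage_setT.
rewrite (@fubini_tonelli1 _ _ _ _ R (@lebesgue_measure R) (@lebesgue_rV R n) (F \o @cons_rV R n))//.
  exact (measurableT_comp mF mcons).
by move=> x; exact: F0.
Qed.

Lemma measurable_cons_rVr n (x : R) :
  measurable_fun setT (fun v : 'rV[R]_n => cons_rV (x, v)).
Proof.
apply/measurable_fun_rVP => i; case: (unliftP ord0 i) => [j ->|->].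
- by under eq_fun do rewrite cons_rVS/=; exact: measurable_coord_rV.
- by under eq_fun do rewrite cons_rV0/=; exact: measurable_cst.
Qed.

Lemma measurable_lebesgue_rVS n (F : 'rV[R]_n.+1 -> \bar R) :
  measurable_fun setT F -> (forall v, 0 <= F v) ->
  measurable_fun setT (fun x => \int[lebesgue_rV]_v F (cons_rV (x, v))).
Proof.
move=> mF F0; have mcons := @measurable_cons_rV R n.
apply: (@measurable_fun_fubini_tonelli_F _ _ (measurableTypeR R) _ R
  (@lebesgue_rV R n) (F \o @cons_rV R n)) => //.
  exact (measurableT_comp mF mcons).
by move=> x; exact: F0.
Qed.

(** Uniqueness of Lebesgue measure: twice its image under [2 * x - a] gives every half-open interval
    its length. *)
Lemma ge0_integral_lebesgue_double (a : R) (F : R -> \bar R) :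
  measurable_fun setT F -> (forall x, 0 <= F x) ->
  \int[lebesgue_measure]_x F x =
  2%:E * \int[lebesgue_measure]_x F (2 * x - a)%R.
Proof.
move=> mF F0.
pose g (x : R) := (2 * x - a)%R.
have mg : measurable_fun setT (g : measurableTypeR R -> measurableTypeR R).
  by apply: measurable_funB => //; exact: measurable_funM.
have two0 : (0 <= 2 :> R)%R by [].
rewrite (@eq_integral_density _ _ (measurableTypeR R) (measurableTypeR R) R
  lebesgue_measure lebesgue_measure g (cst 2%R) F)//.
- under eq_integral do rewrite muleC /=.
  by rewrite ge0_integralZl//; exact: (measurableT_comp mF mg).
move=> A mA; have mgA := measurable_preimageT mg mA.
rewrite [RHS](integral_cst lebesgue_measure mgA 2%:E).
pose nu : {measure set (measurableTypeR R) -> \bar R} :=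
  measure_function_pushforward__canonical__measure_function_Measure
    (@lebesgue_measure R) mg.
transitivity (mscale (NngNum two0) nu A); last by [].
apply: lebesgue_measure_unique => // _ [[b c] /= _ <-].
rewrite /mscale/= /pushforward.
have -> : g @^-1` `]b, c] = `]((b + a) / 2)%R, ((c + a) / 2)%R]%classic.
  apply/seteqP; split => x /=; rewrite !in_itv/= /g => /andP[bx xc];
  apply/andP; split; lra.
rewrite !lebesgue_measure_itv/= !lte_fin.
have [bc|cb] := ltP b c.
  rewrite ifT; last by lra.
  by rewrite -!EFinB -EFinM; congr EFin; lra.
by rewrite ifF ?mule0//; apply/negbTE; rewrite -leNgt; lra.
Qed.

(** The map is the dilation by two centred at [a], that is h -> 2 h for h = v - a. Tonelli peels off
    one coordinate at a time, each contributing a factor 2. *)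
Lemma ge0_integral_lebesgue_rV_double n (a : 'rV[R]_n) (F : 'rV[R]_n -> \bar R) :
  measurable_fun setT F -> (forall x, 0 <= F x) ->
  \int[lebesgue_rV]_v F v =
  (2 ^+ n)%:E * \int[lebesgue_rV]_v F (2 *: v - a)%R.
Proof.
elim: n => [|n IH] in a F *.
  move=> mF F0; have -> : (fun v => F (2 *: v - a)%R) = F.
    by apply/funext => v; congr F; rewrite [LHS]thinmx0 [RHS]thinmx0.
  by rewrite expr0 mul1e.
move=> mF F0.
have maff m (b : 'rV[R]_m) : measurable_fun setT (fun v : 'rV[R]_m => (2 *: v - b)%R).
  apply/measurable_fun_rVP => i; under eq_fun do rewrite !mxE.
  by apply: measurable_funB => //; apply: measurable_funM => //; exact: measurable_coord_rV.
rewrite integral_lebesgue_rVS//.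
rewrite (ge0_integral_lebesgue_double (a ord0 ord0))//; last 2 first.
- exact: measurable_lebesgue_rVS.
- by move=> x; exact: integral_ge0.
rewrite integral_lebesgue_rVS//; last exact: (measurableT_comp mF (maff _ a)).
rewrite exprS EFinM -muleA; congr (_ * _).
rewrite -ge0_integralZl//; last 2 first.
- apply: (@measurable_lebesgue_rVS n (fun v => F (2 *: v - a)%R)) => //.
  exact: (measurableT_comp mF (maff _ a)).
- by move=> x _; exact: integral_ge0.
apply: eq_integral => x _.
pose b : 'rV[R]_n := \row_j a ord0 (lift ord0 j).
rewrite (IH b (fun v => F (cons_rV ((2 * x - a ord0 ord0)%R, v))))//; last first.
  exact: (measurableT_comp mF (measurable_cons_rVr _)).
congr (_ * _); apply: eq_integral => v _; congr F.
apply/rowP => i; case: (unliftP ord0 i) => [j ->|->].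
- by rewrite cons_rVS !mxE liftK.
- by rewrite cons_rV0 !mxE unlift_none.
Qed.

Lemma measurable_rV_set1 n (a : 'rV[R]_n) : measurable [set a].
Proof.
have -> : [set a] = \bigcap_(i in [set: 'I_n]) [set v : 'rV[R]_n | v ord0 i = a ord0 i].
  apply/seteqP; split => [v /= -> //|v /= va].
  by apply/rowP => i; exact: va.
apply: fin_bigcap_measurable => // i _.
exact: (measurable_preimageT (@measurable_coord_rV R n i) (measurable_set1 _)).
Qed.

(** Used to see that the prior has no atom at [theta0]. In dimension 0 the measure is a Dirac mass,
    hence the condition on [n]. *)
Lemma lebesgue_rV_set1 n (a : 'rV[R]_n) : (0 < n)%N -> lebesgue_rV [set a] = 0.
Proof.
case: n a => // n a _.
rewrite /= /pushforward.
have -> : @cons_rV R n @^-1` [set a] =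
    [set a ord0 ord0] `*` [set (\row_j a ord0 (lift ord0 j))].
  apply/seteqP; split => [[x v]/= <-|[x v]/= [-> ->]].
    by rewrite cons_rV0; split => //; apply/rowP => j; rewrite mxE cons_rVS.
  apply/rowP => i; case: (unliftP ord0 i) => [j ->|->].
  - by rewrite cons_rVS mxE.
  - by rewrite cons_rV0.
have l0 : lebesgue_measure [set a ord0 ord0] = 0 by exact: lebesgue_measure_set1.
rewrite product_measure1E//; last exact: measurable_rV_set1.
by rewrite [X in X * _]l0 mul0e.
Qed.
End lebesgue_doubling.

(** * Measurability and Euclidean geometry of row vectors *)

Section continuous_measurable_rV.
Context {R : realType} {n : nat}.

Let mesh (k : nat) : R := k.+1%:R.

Let cell (k : nat) (v : 'rV[R]_n) : {ffun 'I_n -> int} :=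
  [ffun i => Num.floor (mesh k * v ord0 i)].

Let node (k : nat) (z : {ffun 'I_n -> int}) : 'rV[R]_n :=
  \row_i ((z i)%:~R / mesh k).

Let mesh_gt0 k : 0 < mesh k. Proof. by rewrite ltr0n. Qed.

Let measurable_cell k z : measurable [set v | cell k v = z].
Proof.
have -> : [set v | cell k v = z] = \bigcap_(i in [set: 'I_n])
    [set v : 'rV[R]_n | Num.floor (mesh k * v ord0 i) = z i].
  apply/seteqP; split => [v /= <- i _ /=|v /= vz]; first by rewrite ffunE.
  by apply/ffunP => i; rewrite ffunE; exact: vz.
apply: fin_bigcap_measurable => // i _.
have -> : [set v : 'rV[R]_n | Num.floor (mesh k * v ord0 i) = z i] =
    (fun v : 'rV[R]_n => mesh k * v ord0 i) @^-1` `[(z i)%:~R, (z i + 1)%:~R[.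
  by apply/seteqP; split => v /=; rewrite in_itv/= -floor_eq => /eqP.
apply: measurable_preimageT => //.
by apply: measurable_funM => //; exact: measurable_coord_rV.
Qed.

(** The function is constant on each cell and there are countably many cells, so every preimage is a
    countable union of measurable cells. *)
Let measurable_node k (f : 'rV[R]_n -> R) :
  measurable_fun setT (fun v => f (node k (cell k v))).
Proof.
move=> _ B mB; rewrite setTI.
have -> : (fun v => f (node k (cell k v))) @^-1` B =
  \bigcup_z (if `[< B (f (node k z)) >] then [set v | cell k v = z] else set0).
  apply/seteqP; split => [v /= Bv|v [z _]].
    by exists (cell k v) => //; case: ifPn => // /asboolP.
  by case: ifPn => // /asboolP Bz /= ->.
apply: countable_bigcupT_measurable => // z; by case: ifPn.
Qed.

(* The sigma-algebra of ['rV[R]_n] is generated by the coordinates and not by the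
   open sets: [f] is approximated by its values at the nodes of finer and finer
   grids. *)
Lemma continuous_measurable_rV (f : 'rV[R]_n -> R) :
  continuous f -> measurable_fun setT f.
Proof.
move=> cf; apply: (@measurable_fun_cvg _ _ _ _ (fun k v => f (node k (cell k v)))).
  by move=> k; exact: measurable_node.
move=> v _; apply: (continuous_cvg _ (cf v)).
apply/cvgrPdist_le => /= e e0.
near=> k.
rewrite /Num.norm/= mx_normrE; apply/bigmax_leP; split; first exact: ltW.
move=> [i j] _ /=; rewrite !mxE ffunE ord1.
have /andP[lo hi] := floor_itv (mesh k * v ord0 j).
have k0 := mesh_gt0 k.
have ke : (mesh k)^-1 < e.
  by near: k; exact: (near_infty_natSinv_lt (PosNum e0)).
set z := (Num.floor _)%:~R in lo *.
have -> : v ord0 j - z / mesh k = (mesh k * v ord0 j - z) / mesh k.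
  by rewrite mulrBl mulrAC divff ?gt_eqF// mul1r.
rewrite normrM (ger0_norm (_ : 0 <= (mesh k)^-1)) ?invr_ge0 ?ltW//.
apply: le_lt_trans ke; rewrite ler_piMl ?invr_ge0 ?ltW//.
rewrite ger0_norm ?subr_ge0//; move: hi; rewrite intrD; lra.
Unshelve. all: by end_near.
Qed.

End continuous_measurable_rV.

Section euclidean_theory.
Context {R : realType} {n : nat}.
Implicit Types (u v w : 'rV[R]_n) (a : R).

Lemma dotvC u v : dotv u v = dotv v u.
Proof. by apply: eq_bigr => i _; rewrite mulrC. Qed.

Lemma dotvDl u v w : dotv (u + v) w = dotv u w + dotv v w.
Proof. by rewrite -big_split; apply: eq_bigr => i _; rewrite mxE mulrDl. Qed.

Lemma dotvZl a u v : dotv (a *: u) v = a * dotv u v.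
Proof. by rewrite /dotv mulr_sumr; apply: eq_bigr => i _; rewrite mxE mulrA. Qed.

Lemma dotvDr u v w : dotv w (u + v) = dotv w u + dotv w v.
Proof. by rewrite !(dotvC w) dotvDl. Qed.

Lemma dotvZr a u v : dotv v (a *: u) = a * dotv v u.
Proof. by rewrite !(dotvC v) dotvZl. Qed.

Lemma dotvNl u v : dotv (- u) v = - dotv u v.
Proof. by rewrite -scaleN1r dotvZl mulN1r. Qed.

Lemma dotvNr u v : dotv v (- u) = - dotv v u.
Proof. by rewrite !(dotvC v) dotvNl. Qed.

Lemma dotv_ge0 u : 0 <= dotv u u.
Proof. by apply: sumr_ge0 => i _; rewrite -expr2 sqr_ge0. Qed.

Lemma eucl_norm_ge0 u : 0 <= eucl_norm u.
Proof. exact: sqrtr_ge0. Qed.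

Lemma sqr_eucl_norm u : eucl_norm u ^+ 2 = dotv u u.
Proof. by rewrite sqr_sqrtr// dotv_ge0. Qed.

Lemma eucl_normZ a u : eucl_norm (a *: u) = `|a| * eucl_norm u.
Proof.
by rewrite /eucl_norm dotvZl dotvZr mulrA -expr2 sqrtrM ?sqr_ge0// sqrtr_sqr.
Qed.

Lemma eucl_norm0 : eucl_norm (0 : 'rV[R]_n) = 0.
Proof. by rewrite -(scale0r (0 : 'rV[R]_n)) eucl_normZ normr0 mul0r. Qed.

Lemma normr_le_eucl_norm u i : `|u ord0 i| <= eucl_norm u.
Proof.
rewrite -sqrtr_sqr; apply: ler_wsqrtr.
rewrite /dotv (bigD1 i)//= -expr2 lerDl.
by apply: sumr_ge0 => j _; rewrite -expr2 sqr_ge0.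
Qed.

Lemma eucl_norm_eq0 u : (eucl_norm u == 0) = (u == 0).
Proof.
apply/idP/idP => [/eqP u0|/eqP ->]; last by rewrite eucl_norm0.
apply/eqP/rowP => i; rewrite mxE; apply/eqP; rewrite -normr_le0 -u0.
exact: normr_le_eucl_norm.
Qed.

Lemma eucl_norm_le_sum u : eucl_norm u <= \sum_i `|u ord0 i|.
Proof.
have s0 : 0 <= \sum_i `|u ord0 i| by apply: sumr_ge0.
rewrite -(ler_pXn2r (_ : 0 < 2)%N) ?nnegrE ?eucl_norm_ge0// sqr_eucl_norm.
rewrite expr2 /dotv mulr_suml; apply: ler_sum => i _.
rewrite (le_trans (ler_norm _))// normrM ler_wpM2l//.
by rewrite (bigD1 i)//= lerDl; apply: sumr_ge0.
Qed.

Lemma normr_dotv_le u v : `|dotv u v| <= eucl_norm u * \sum_i `|v ord0 i|.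
Proof.
rewrite (le_trans (ler_norm_sum _ _ _))// mulr_sumr; apply: ler_sum => i _.
by rewrite normrM ler_wpM2r// normr_le_eucl_norm.
Qed.

End euclidean_theory.

Lemma measurable_sqrtr (R : realType) : measurable_fun setT (@Num.sqrt R).
Proof.
by apply: continuous_measurable_fun => x; exact: sqrt_continuous.
Qed.

Lemma measurable_subr_rV (R : realType) n (a : 'rV[R]_n) :
  measurable_fun setT (fun v : 'rV[R]_n => v - a).
Proof.
apply/measurable_fun_rVP => i; under eq_fun do rewrite !mxE.
by apply: measurable_funB => //; exact: measurable_coord_rV.
Qed.

Lemma measurable_eucl_norm (R : realType) n :
  measurable_fun setT (@eucl_norm R n).
Proof.
apply: (measurableT_comp (@measurable_sqrtr R)).
by apply: measurable_sum => i; apply: measurable_funM; exact: measurable_coord_rV.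
Qed.

Lemma measurable_eucl_dist (R : realType) n (a : 'rV[R]_n) :
  measurable_fun setT (fun v : 'rV[R]_n => eucl_norm (v - a)).
Proof.
exact: (measurableT_comp (@measurable_eucl_norm R n) (@measurable_subr_rV R n a)).
Qed.

(** * Strongly convex potentials *)

Section strong_convexity.
Context {R : realType} {n : nat}.
Variables (U : 'rV[R]_n -> R) (m : R).
Hypothesis U_convex : forall (x y : 'rV[R]_n) (t : R), 0 <= t <= 1 ->
  U (t *: x + (1 - t) *: y) <=
  t * U x + (1 - t) * U y - m / 2 * t * (1 - t) * eucl_norm (x - y) ^+ 2.

(* On a small sphere [U] is bounded; writing [a] as a convex combination of
   [a + u] and of the antipodal point of the sphere turns this into a lower
   bound along the whole ray. *)
Lemma strongly_convex_lower (a : 'rV[R]_n) : 0 <= m -> {for a, continuous U} ->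
  exists2 L : R, 0 <= L & forall u,
    U a - L * eucl_norm u + m / 2 * eucl_norm u ^+ 2 <= U (a + u).
Proof.
move=> m0 Ua.
have /nbhs_ballP[e /= e0 He] : nbhs a [set y | `|U a - U y| < 1].
  exact: (@cvgr_dist_lt _ _ _ _ _ U (U a) Ua 1 ltr01).
pose r := e / 2.
have r0 : 0 < r by rewrite divr_gt0.
have Ur w : eucl_norm w = r -> U (a + w) <= U a + 1.
  move=> wr; suff : `|U a - U (a + w)| < 1 by rewrite ltr_norml => /andP[]; lra.
  apply: He; split => // i j; rewrite ord1 /ball/= mxE opprD addNKr normrN.
  by rewrite (le_lt_trans (normr_le_eucl_norm _ _))// wr /r; lra.
pose K := 1 + m / 2 * r ^+ 2.
exists (K / r); first by rewrite divr_ge0 ?addr_ge0 ?mulr_ge0 ?sqr_ge0// ltW.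
move=> u; have [->|u0] := eqVneq u 0.
  by rewrite addr0 eucl_norm0 expr0n/= !mulr0 subr0 addr0.
set s := eucl_norm u.
have s0 : 0 < s by rewrite lt_neqAle eucl_norm_ge0 eq_sym eucl_norm_eq0 u0.
have rs0 : 0 < r + s by lra.
pose w := - (r / s) *: u.
have wr : eucl_norm w = r.
  rewrite eucl_normZ normrN ger0_norm ?divr_ge0 ?ltW// -/s.
  by rewrite mulfVK// gt_eqF.
pose t := r / (r + s).
have t01 : 0 <= t <= 1.
  rewrite /t divr_ge0 ?(ltW r0) ?(ltW rs0)//=.
  by rewrite ler_pdivrMr// mul1r lerDl ltW.
have t1 : 1 - t = s / (r + s).
  by rewrite /t; field; lra.
have auw : t *: (a + u) + (1 - t) *: (a + w) = a.
  rewrite !scalerDr addrACA -scalerDl subrKC scale1r.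
  rewrite t1 /w scalerA -scalerDl.
  rewrite (_ : t + _ = 0) ?scale0r ?addr0//.
  by rewrite /t; field; apply/andP; split; lra.
have auw' : a + u - (a + w) = (1 + r / s) *: u.
  by rewrite opprD addrACA subrr add0r /w scaleNr opprK scalerDl scale1r.
have := U_convex (a + u) (a + w) t01.
have rs1 : 0 <= 1 + r / s by rewrite addr_ge0 ?divr_ge0// ltW.
rewrite auw auw' eucl_normZ (ger0_norm rs1) -/s.
have := Ur w wr; rewrite t1.
set A := U a; set B := U (a + u); set C := U (a + w) => hC hA.
have hA' : (r + s) * A <= r * B + s * C - (r + s) * (m / 2 * r * s).
  have := ler_wpM2l (ltW rs0) hA.
  rewrite [X in _ <= X](_ : _ = r * B + s * C - (r + s) * (m / 2 * r * s))//.
  by rewrite /t; field; apply/andP; split; lra.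
have hB : r * A - s * K + r * (m / 2 * s ^+ 2) <= r * B.
  have : s * C <= s * (A + 1) by rewrite ler_wpM2l// ltW.
  have : 0 <= m * r ^+ 2 * s by rewrite !mulr_ge0 ?sqr_ge0// ltW.
  rewrite /K; lra.
rewrite -(ler_pM2l r0); apply: le_trans hB.
rewrite le_eqVlt; apply/orP; left; apply/eqP; field; lra.
Qed.

(** [v] is the midpoint of [a] and [2 *: v - a], two points at distance twice that of [v] from [a]:
    this is strong convexity at t = 1/2, multiplied by 2. *)
Lemma strongly_convex_double (a v : 'rV[R]_n) :
  2 * U v - U a + m * eucl_norm (v - a) ^+ 2 <= U (2 *: v - a).
Proof.
have h01 : 0 <= (2^-1 : R) <= 1 by lra.
have := U_convex (2 *: v - a) a h01.
have -> : 2^-1 *: (2 *: v - a) + (1 - 2^-1) *: a = v.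
  rewrite scalerBr scalerA mulVf// scale1r -addrA -scaleNr -scalerDl.
  by rewrite (_ : - 2^-1 + _ = 0) ?scale0r ?addr0//; lra.
have -> : 2 *: v - a - a = 2 *: (v - a).
  by rewrite scalerBr -addrA -opprD -[a in a + a]scale1r -scalerDl.
rewrite eucl_normZ ger0_norm// exprMn; lra.
Qed.

End strong_convexity.

(** The factor [2 ^+ n] is the Jacobian, and the exponential bounds the ratio of the prior densities
    at [2 *: v - a] and at [v], where the normalizing constant cancels. By [strongly_convex_double],
    U(2 v - a) - U(v) is at least U(v) - U(a) + m |v - a|^2, and [strongly_convex_lower] bounds U(v)
    - U(a) below by - L |v - a|. All later use of the prior's shape near [a] or at infinity goes
    through this inequality. *)
Lemma prior_doubling (R : realType) (n : nat) (U : 'rV[R]_n -> R)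
  (prior : probability 'rV[R]_n R) (a : 'rV[R]_n) :
  continuous U -> strongly_convex U -> has_density_propto_exp prior U ->
  exists L m : R, [/\ 0 <= L, 0 < m & forall F : 'rV[R]_n -> \bar R,
    measurable_fun setT F -> (forall v, 0 <= F v)%E ->
    (\int[prior]_v F v <= (2 ^+ n)%:E * \int[prior]_v (F (2 *: v - a)%R *
      (expR (L * eucl_norm (v - a) - m * eucl_norm (v - a) ^+ 2))%:E))%E].
Proof.
move=> cU [m m0 Uconv] [c c0 hprior].
have [L L0 Ulow] := strongly_convex_lower Uconv (ltW m0) (cU a).
exists L, m; split => // F mF F0.
have mU := continuous_measurable_rV cU.
pose w v := c * expR (- U v).
have mw : measurable_fun setT w.
  by apply: measurable_funM => //; apply: measurableT_comp => //; exact: measurable_funN.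
have w0 v : 0 <= w v by rewrite mulr_ge0 ?expR_ge0// ltW.
have priorE A : measurable A -> (prior A = \int[lebesgue_rV]_(x in id @^-1` A) (w x)%:E)%E.
  move=> mA; rewrite hprior//; under [RHS]eq_integral do rewrite EFinM.
  rewrite ge0_integralZl ?lee_fin ?(ltW c0)//.
  apply/measurable_EFinP/measurable_funTS.
  by apply: measurableT_comp => //; exact: measurable_funN.
have intE G : measurable_fun setT G -> (forall v, 0 <= G v)%E ->
    (\int[prior]_v G v = \int[lebesgue_rV]_v (G v * (w v)%:E))%E.
  by move=> mG G0; exact: (@eq_integral_density _ _ _ _ _ _ _ id w).
have maff : measurable_fun setT (fun v : 'rV[R]_n => 2 *: v - a).
  apply/measurable_fun_rVP => i; under eq_fun do rewrite !mxE.
  by apply: measurable_funB => //; apply: measurable_funM => //; exact: measurable_coord_rV.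
pose E v := expR (L * eucl_norm (v - a) - m * eucl_norm (v - a) ^+ 2).
have mE : measurable_fun setT E.
  have md := @measurable_eucl_dist R n a.
  apply: measurableT_comp => //; apply: measurable_funB; apply: measurable_funM => //.
  exact: measurable_funX.
rewrite (intE F)// (intE (fun v => F (2 *: v - a)%R * (E v)%:E)%E); last 2 first.
- apply: emeasurable_funM; first exact: measurableT_comp.
  exact/measurable_EFinP.
- by move=> v; rewrite mule_ge0// lee_fin expR_ge0.
have mFw : measurable_fun setT (fun v => F v * (w v)%:E)%E.
  by apply: emeasurable_funM => //; exact/measurable_EFinP.
rewrite (ge0_integral_lebesgue_rV_double a)//; last first.
  by move=> v; rewrite mule_ge0// lee_fin.
rewrite lee_pmul2l// ?lte_fin ?exprn_gt0//.
apply: ge0_le_integral => //.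
- by move=> v _; rewrite mule_ge0// lee_fin.
- exact: (measurableT_comp mFw maff).
- apply: emeasurable_funM; last exact/measurable_EFinP.
  apply: emeasurable_funM; first exact: measurableT_comp.
  exact/measurable_EFinP.
- move=> v _; rewrite -muleA lee_wpmul2l// -EFinM lee_fin /w /E mulrCA.
  apply: ler_wpM2l; first exact: ltW.
  rewrite -expRD ler_expR.
  have := strongly_convex_double Uconv a v; have := Ulow (v - a).
  rewrite subrKC; have := sqr_ge0 (eucl_norm (v - a)); nra.
Qed.

(** * Integrals over the unit interval and orthogonality of sines *)

Section unit_integral.
Context {R : realType}.
Implicit Types (f g F : R -> R).

Definition int01 f : R := \int[lebesgue_measure]_(x in `[0, 1]) f x.

Lemma int01_integrable f : continuous f ->
  lebesgue_measure.-integrable `[0, 1] (EFin \o f).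
Proof.
move=> cf; apply: continuous_compact_integrable; first exact: segment_compact.
exact: continuous_subspaceT.
Qed.

Lemma int01D f g : continuous f -> continuous g ->
  int01 (fun x => f x + g x) = int01 f + int01 g.
Proof. by move=> cf cg; apply: RintegralD => //; exact: int01_integrable. Qed.

Lemma int01Z c f : continuous f -> int01 (fun x => c * f x) = c * int01 f.
Proof. by move=> cf; apply: RintegralZl => //; exact: int01_integrable. Qed.

Lemma int01_cst c : int01 (fun=> c) = c.
Proof.
rewrite /int01 Rintegral_cst//= lebesgue_measure_itv/= lte_fin ltr01.
by rewrite -EFinB/= subr0 mulr1.
Qed.

Lemma le_int01 f g : continuous f -> continuous g ->
  (forall x, f x <= g x) -> int01 f <= int01 g.
Proof. by move=> cf cg fg; apply: le_Rintegral => //; exact: int01_integrable. Qed.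

Lemma eq_int01 f g : f =1 g -> int01 f = int01 g.
Proof. by move=> fg; congr int01; exact/funext. Qed.

Lemma continuous_funD f g : continuous f -> continuous g ->
  continuous (fun x => f x + g x).
Proof. by move=> cf cg x; apply: cvgD; [exact: cf|exact: cg]. Qed.

Lemma continuous_funM f g : continuous f -> continuous g ->
  continuous (fun x => f x * g x).
Proof. by move=> cf cg x; apply: cvgM; [exact: cf|exact: cg]. Qed.

Lemma continuous_funC (c : R) : continuous (fun _ : R => c).
Proof. by move=> x; exact: cvg_cst. Qed.

Lemma continuous_fun_norm f : continuous f -> continuous (fun x => `|f x|).
Proof. by move=> cf x; apply: cvg_norm; exact: cf. Qed.

Lemma continuous_fun_expR f : continuous f -> continuous (fun x => expR (f x)).
Proof.
by move=> cf x; apply: (@continuous_comp _ _ _ f expR); [exact: cf|exact: continuous_expR].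
Qed.

Lemma continuous_sinM (c : R) : continuous (fun x : R => sin (c * x)).
Proof.
move=> x; apply: (@continuous_comp _ _ _ (fun x => c * x) sin).
  by apply: continuous_funM; [exact: continuous_funC|move=> ?; exact: cvg_id].
exact: continuous_sin.
Qed.

Lemma continuous_cosM (c : R) : continuous (fun x : R => cos (c * x)).
Proof.
move=> x; apply: (@continuous_comp _ _ _ (fun x => c * x) cos).
  by apply: continuous_funM; [exact: continuous_funC|move=> ?; exact: cvg_id].
exact: continuous_cos.
Qed.

Lemma continuous_bigsum (I : Type) (r : seq I) (f : I -> R -> R) :
  (forall i, continuous (f i)) -> continuous (fun x => \sum_(i <- r) f i x).
Proof.
move=> cf; elim: r => [|i r IH].
  by under eq_fun do rewrite big_nil; exact: continuous_funC.
by under eq_fun do rewrite big_cons; exact: continuous_funD.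
Qed.

Lemma int01_sum (I : Type) (r : seq I) (f : I -> R -> R) :
  (forall i, continuous (f i)) ->
  int01 (fun x => \sum_(i <- r) f i x) = \sum_(i <- r) int01 (f i).
Proof.
move=> cf; elim: r => [|i r IH].
  by under eq_int01 do rewrite big_nil; rewrite int01_cst big_nil.
under eq_int01 do rewrite big_cons.
rewrite int01D ?IH ?big_cons//; exact: continuous_bigsum.
Qed.

Lemma normr_int01 f : continuous f -> `|int01 f| <= int01 (fun x => `|f x|).
Proof. by move=> cf; apply: le_normr_Rintegral => //; exact: int01_integrable. Qed.

Lemma int01_FTC f F : continuous f -> (forall x, is_derive x (1 : R) F (f x)) ->
  int01 f = F 1 - F 0.
Proof.
move=> cf dF.
have cF : continuous F.
  move=> x; apply: differentiable_continuous; apply/derivable1_diffP.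
  by have [] := dF x.
rewrite /int01 /Rintegral (@continuous_FTC2 _ f F) ?ltr01//.
- exact: continuous_subspaceT.
- split=> [x _||]; first by have [] := dF x.
  + exact: cvg_at_right_filter (cF 0).
  + exact: cvg_at_left_filter (cF 1).
- by move=> x _; rewrite derive1E; exact: derive_val.
Qed.

End unit_integral.

Section sine_orthogonality.
Context {R : realType}.

Lemma sin_natpi k : sin (k%:R * pi) = 0 :> R.
Proof. by rewrite mulr_natl -[_ *+ _]add0r (alternatingn (@sinDpi R)) sin0 mulr0. Qed.

Lemma cos_natpi k : cos (k%:R * pi) = (-1) ^+ k :> R.
Proof. by rewrite mulr_natl -[_ *+ _]add0r (alternatingn (@cosDpi R)) cos0 mulr1. Qed.

Let is_derive_mulr (c x : R) : is_derive x (1 : R) (fun y : R => c * y) c.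
Proof. by apply: is_derive_eq; rewrite /GRing.scale/= mulr1. Qed.

Lemma int01_cos (k : nat) : (0 < k)%N -> int01 (fun x : R => cos (k%:R * pi * x)) = 0.
Proof.
move=> k0; have kpi0 : k%:R * pi != 0 :> R.
  by rewrite mulf_neq0 ?pnatr_eq0 -?lt0n// gt_eqF// pi_gt0.
have D x : is_derive x (1 : R)
    (fun y => (k%:R * pi)^-1 * sin (k%:R * pi * y)) (cos (k%:R * pi * x)).
  have h1 : is_derive x (1:R) (fun y => sin (k%:R * pi * y)) (cos (k%:R * pi * x) * (k%:R * pi)).
    exact: (@is_derive1_comp _ sin (fun y => k%:R * pi * y)).
  by apply: is_derive_eq; rewrite /GRing.scale/= mulrC mulfK.
rewrite (int01_FTC (@continuous_cosM R _) D).
by rewrite mulr1 mulr0 sin0 sin_natpi !mulr0 subr0.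
Qed.

Lemma int01_sin (k : nat) : (0 < k)%N ->
  int01 (fun x : R => sin (k%:R * pi * x)) = (1 - (-1) ^+ k) / (k%:R * pi).
Proof.
move=> k0; have kpi0 : k%:R * pi != 0 :> R.
  by rewrite mulf_neq0 ?pnatr_eq0 -?lt0n// gt_eqF// pi_gt0.
have D x : is_derive x (1 : R)
    (fun y => - (k%:R * pi)^-1 * cos (k%:R * pi * y)) (sin (k%:R * pi * x)).
  have h1 : is_derive x (1:R) (fun y => cos (k%:R * pi * y)) (- sin (k%:R * pi * x) * (k%:R * pi)).
    exact: (@is_derive1_comp _ cos (fun y => k%:R * pi * y)).
  by apply: is_derive_eq; rewrite /GRing.scale/= mulNr (mulNr (sin _)) mulrN opprK mulrC mulfK.
rewrite (int01_FTC (@continuous_sinM R _) D).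
by rewrite mulr1 mulr0 cos0 cos_natpi; set e := (-1) ^+ k; ring.
Qed.

Lemma int01_sin_sin (j k : nat) : (0 < j)%N -> (0 < k)%N ->
  int01 (fun x : R => sin (j%:R * pi * x) * sin (k%:R * pi * x)) =
  if j == k then 2^-1 else 0.
Proof.
wlog jk : j k / (k <= j)%N => [th j0 k0|j0 k0].
  have [kj|/ltnW jk] := leqP k j; first exact: th.
  by rewrite eq_sym -th//; apply: eq_int01 => x; rewrite mulrC.
have -> : int01 (fun x : R => sin (j%:R * pi * x) * sin (k%:R * pi * x)) =
    int01 (fun x => 2^-1 * cos ((j - k)%:R * pi * x) + - 2^-1 * cos ((j + k)%:R * pi * x)).
  apply: eq_int01 => x; rewrite natrB// natrD.
  by rewrite !mulrDl mulNr !mulNr cosB cosD; lra.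
rewrite int01D; try by apply: continuous_funM; [exact: continuous_funC|exact: continuous_cosM].
rewrite !int01Z; try exact: continuous_cosM.
rewrite (@int01_cos (j + k)) ?addn_gt0 ?j0// mulr0 addr0.
have [->|neq] := eqVneq j k.
  rewrite subnn; under eq_int01 do rewrite !mul0r cos0.
  by rewrite int01_cst mulr1.
by rewrite int01_cos ?mulr0// subn_gt0 ltn_neqAle eq_sym neq.
Qed.

End sine_orthogonality.

(** * Quantitative linear independence of the sines and the constants, in L^1 norm *)

Section sine_features_theory.
Context {R : realType} {N : nat}.
Implicit Types (u h : 'rV[R]_N).

Lemma dotv_sine_features h x :
  dotv h (sine_features x) = \sum_(k < N) h ord0 k * sin (k.+1%:R * pi * x).
Proof. by apply: eq_bigr => k _; rewrite mxE. Qed.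

Lemma normr_sine_features (k : 'I_N) (x : R) : `|sine_features x ord0 k| <= 1.
Proof. by rewrite mxE; exact: sin_max. Qed.

Lemma continuous_dotv_sine h : continuous (fun x : R => dotv h (sine_features x)).
Proof.
under eq_fun do rewrite dotv_sine_features.
apply: continuous_bigsum => k; apply: continuous_funM; first exact: continuous_funC.
exact: continuous_sinM.
Qed.

Lemma normr_dotv_sine_le h (x : R) :
  `|dotv h (sine_features x)| <= eucl_norm h * N%:R.
Proof.
apply: le_trans (normr_dotv_le _ _) _.
rewrite ler_wpM2l ?eucl_norm_ge0//.
rewrite (@le_trans _ _ (\sum_(k < N) 1))//.
  by apply: ler_sum => k _; exact: normr_sine_features.
by rewrite sumr_const card_ord.
Qed.

(* [psi], a combination of [sin (k pi x)] and of a sine of odd frequency larger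
   than [N], is orthogonal to constants, and its integral against
   [dotv h (sine_features x)] isolates the [k]-th coordinate of [h]. *)
Lemma int01_sine_L1_ge : exists2 k : R, 0 < k & forall h a,
  k * eucl_norm h <= int01 (fun x => `|dotv h (sine_features x) + a|).
Proof.
pose M := N.*2.+1.
pose s (j : nat) (x : R) := sin (j%:R * pi * x).
have cs j : continuous (s j) by exact: continuous_sinM.
(* [M] is odd, so this integral is 2 / (M pi). An even frequency would integrate to zero and could
   not cancel the mean of [s k.+1]. *)
have cM : int01 (s M) != 0.
  rewrite int01_sin// -signr_odd /= odd_double/= expr1 opprK.
  by rewrite mulf_neq0 ?invr_eq0 ?mulf_neq0// gt_eqF// pi_gt0.
pose r (k : 'I_N) := - (int01 (s k.+1) / int01 (s M)).
pose psi (k : 'I_N) x := s k.+1 x + r k * s M x.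
have crs k : continuous (fun x => r k * s M x).
  by apply: continuous_funM; [exact: continuous_funC|exact: cs].
have cpsi k : continuous (psi k) by apply: continuous_funD.
have psi0 k : int01 (psi k) = 0.
  by rewrite /psi int01D// int01Z// /r mulNr mulfVK// subrr.
have psis k (j : 'I_N) : int01 (fun x => psi k x * s j.+1 x) = if k == j then 2^-1 else 0.
  have c1 : continuous (fun x => s k.+1 x * s j.+1 x) by exact: continuous_funM.
  have c2 : continuous (fun x => s M x * s j.+1 x) by exact: continuous_funM.
  have -> : int01 (fun x => psi k x * s j.+1 x) =
      int01 (fun x => s k.+1 x * s j.+1 x + r k * (s M x * s j.+1 x)).
    by apply: eq_int01 => x; rewrite /psi mulrDl mulrA.
  rewrite int01D//; last by apply: continuous_funM => //; exact: continuous_funC.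
  rewrite int01Z// !int01_sin_sin// [M == _]gtn_eqF ?mulr0 ?addr0//.
  by rewrite ltnS (leq_trans (ltn_ord j))// -addnn leq_addr.
have psih k h a : int01 (fun x => psi k x * (dotv h (sine_features x) + a)) = h ord0 k / 2.
  have -> : int01 (fun x => psi k x * (dotv h (sine_features x) + a)) =
      int01 (fun x => \sum_(j < N) h ord0 j * (psi k x * s j.+1 x) + a * psi k x).
    apply: eq_int01 => x; rewrite mulrDr dotv_sine_features mulr_sumr.
    rewrite (mulrC a); congr (_ + _).
    by apply: eq_bigr => j _; rewrite mulrCA.
  have ch j : continuous (fun x => h ord0 j * (psi k x * s j.+1 x)).
    by apply: continuous_funM; [exact: continuous_funC|exact: continuous_funM].
  rewrite int01D; last 2 first.
  - exact: continuous_bigsum.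
  - by apply: continuous_funM; [exact: continuous_funC|exact: cpsi].
  rewrite int01Z// psi0 mulr0 addr0 int01_sum// (bigD1 k)//= big1 => [|j jk].
    by rewrite addr0 int01Z ?psis ?eqxx//; exact: continuous_funM.
  by rewrite int01Z ?psis 1?eq_sym ?(negbTE jk) ?mulr0//; exact: continuous_funM.
(* A sup bound for [psi k]: pairing with a bounded function is controlled by the L^1 norm, so each
   coordinate of [h] is at most [2 * C k] times the integral, whatever the constant [a] is. *)
pose C (k : 'I_N) := 1 + `|r k|.
have C0 k : 0 <= C k by rewrite addr_ge0.
have psiC k x : `|psi k x| <= C k.
  apply: le_trans (ler_normD _ _) _; rewrite lerD ?sin_max// normrM.
  by rewrite ler_piMr// sin_max.
pose K := 1 + \sum_k 2 * C k.
have K0 : 0 < K by rewrite ltr_pwDl// sumr_ge0// => k _; rewrite mulr_ge0.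
exists K^-1; first by rewrite invr_gt0.
move=> h a; rewrite ler_pdivrMl//.
set I := int01 _.
have cha : continuous (fun x => dotv h (sine_features x) + a).
  by apply: continuous_funD; [exact: continuous_dotv_sine|exact: continuous_funC].
have cnha := continuous_fun_norm cha.
have I0 : 0 <= I.
  rewrite -(int01_cst (0 : R)); apply: le_int01 => //; exact: continuous_funC.
have hk k : `|h ord0 k| <= 2 * C k * I.
  have -> : h ord0 k = 2 * int01 (fun x => psi k x * (dotv h (sine_features x) + a)).
    by rewrite psih mulrC mulfVK.
  rewrite normrM ger0_norm// -mulrA ler_pM2l//.
  have cp : continuous (fun x => psi k x * (dotv h (sine_features x) + a)).
    exact: continuous_funM.
  rewrite (le_trans (normr_int01 cp))// /I -int01Z//.
  apply: le_int01.
  - exact: continuous_fun_norm.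
  - by apply: continuous_funM; [exact: continuous_funC|].
  - by move=> x; rewrite normrM ler_wpM2r.
apply: le_trans (eucl_norm_le_sum h) _.
rewrite /K mulrDl mul1r mulr_suml -[leLHS]add0r lerD//.
by apply: ler_sum => k _; exact: hk.
Qed.

End sine_features_theory.

(** * Two lower bounds for the exponential *)

Section real_inequalities.
Context {R : realType}.
Implicit Types x w t a : R.

(* For negative [x] the left-hand side is at most [1 + x]; for nonnegative [x],
   use [2 a x - a ^ 2 <= x ^ 2] and [(1 + x / 2) ^ 2 <= e ^ x]. *)
Lemma expR_ge_norm x a : 1 + x + (a * (`|x| + x) - a ^+ 2) / 4 <= expR x.
Proof.
have [x0|x0] := leP 0 x.
  have h : (1 + x / 2) ^+ 2 <= expR x.
    rewrite [in leRHS](_ : x = 2%:R * (x / 2)); last by field.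
    rewrite expRM_natl ler_pXn2r ?nnegrE ?expR_ge0 ?expR_ge1Dx//.
    by rewrite addr_ge0// divr_ge0.
  rewrite ger0_norm//; apply: le_trans h.
  have := sqr_ge0 (x - a); nra.
rewrite ltr0_norm// addNr mulr0 sub0r.
have := expR_ge1Dx x; have := sqr_ge0 a; nra.
Qed.

(** Bernoulli's inequality y^t >= 1 + t (y - 1) at y = e^w: the graph of y^t lies above its tangent
    at 1. *)
Lemma expRM_ge w t : 1 <= t -> t * expR w - t + 1 <= expR (t * w).
Proof.
move=> t1.
have h1 : 1 + (t - 1) * w <= expR ((t - 1) * w) by exact: expR_ge1Dx.
have h2 : 1 - w <= expR (- w) by exact: expR_ge1Dx.
have h3 : expR w * expR (- w) = 1 by rewrite -expRD subrr expR0.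
have h4 : expR (t * w) = expR w * expR ((t - 1) * w).
  by rewrite -expRD mulrBl mul1r subrKC.
have e0 := expR_ge0 w.
have h5 : expR w * (1 - w) <= 1 by rewrite -[leRHS]h3 ler_wpM2l.
have h6 : expR w * (1 + (t - 1) * w) <= expR (t * w) by rewrite h4 ler_wpM2l.
have : 0 <= t - 1 by lra.
set e := expR w in h5 h6 *; nra.
Qed.

End real_inequalities.

(** * The logistic-Gaussian model around a parameter *)

Section logistic_model.
Context {R : realType} {N : nat}.
Variable theta0 : 'rV[R]_N.
Implicit Types (h : 'rV[R]_N) (f g : R -> R).

Let f0 : R -> R := lg_density theta0.
Let Z (theta : 'rV[R]_N) : R := int01 (fun x => expR (dotv theta (sine_features x))).

Lemma continuous_expR_dotv (theta : 'rV[R]_N) :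
  continuous (fun x : R => expR (dotv theta (sine_features x))).
Proof. by apply: continuous_fun_expR; exact: continuous_dotv_sine. Qed.

Lemma lg_partition_gt0 (theta : 'rV[R]_N) :
  0 < int01 (fun x => expR (dotv theta (sine_features x))).
Proof.
rewrite (@lt_le_trans _ _ (expR (- (eucl_norm theta * N%:R))))// ?expR_gt0//.
rewrite -(int01_cst (expR _)); apply: le_int01.
- exact: continuous_funC.
- exact: continuous_expR_dotv.
- move=> x; rewrite ler_expR lerNl (le_trans (ler_norm _))// normrN.
  exact: normr_dotv_sine_le.
Qed.

Lemma lg_density_gt0 (theta : 'rV[R]_N) x : 0 < lg_density theta x.
Proof. by rewrite divr_gt0 ?expR_gt0//; exact: lg_partition_gt0. Qed.

Lemma continuous_lg_density (theta : 'rV[R]_N) : continuous (lg_density theta).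
Proof.
by apply: continuous_funM; [exact: continuous_expR_dotv|exact: continuous_funC].
Qed.

Definition lg_mean f : R := int01 (fun x => f x * f0 x).

Let cf0 : continuous f0 := @continuous_lg_density theta0.

Let cfM f : continuous f -> continuous (fun x => f x * f0 x).
Proof. by move=> cf; exact: continuous_funM. Qed.

Lemma lg_meanD f g : continuous f -> continuous g ->
  lg_mean (fun x => f x + g x) = lg_mean f + lg_mean g.
Proof.
move=> cf cg; rewrite /lg_mean -int01D; [|exact: cfM..].
by apply: eq_int01 => x; rewrite mulrDl.
Qed.

Lemma lg_meanZ c f : continuous f -> lg_mean (fun x => c * f x) = c * lg_mean f.
Proof.
move=> cf; rewrite /lg_mean -int01Z; last exact: cfM.
by apply: eq_int01 => x; rewrite mulrA.
Qed.

Lemma lg_mean_cst c : lg_mean (fun=> c) = c.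
Proof.
rewrite /lg_mean int01Z// /f0.
rewrite (_ : int01 _ = 1) ?mulr1// /lg_density.
under eq_int01 do rewrite mulrC.
rewrite int01Z; last exact: continuous_expR_dotv.
by rewrite mulVf// gt_eqF// lg_partition_gt0.
Qed.

Lemma le_lg_mean f g : continuous f -> continuous g ->
  (forall x, f x <= g x) -> lg_mean f <= lg_mean g.
Proof.
move=> cf cg fg; apply: le_int01; [exact: cfM..|move=> x].
by rewrite ler_wpM2r// ltW// lg_density_gt0.
Qed.

Lemma eq_lg_mean f g : f =1 g -> lg_mean f = lg_mean g.
Proof. by move=> fg; congr lg_mean; exact/funext. Qed.

Definition sine_mean : 'rV[R]_N :=
  \row_k lg_mean (fun x => sine_features x ord0 k).

Definition centered h x : R := dotv h (sine_features x - sine_mean).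

Lemma centeredE h x :
  centered h x = dotv h (sine_features x) + - dotv h sine_mean.
Proof. by rewrite /centered dotvDr dotvNr. Qed.

Lemma continuous_centered h : continuous (centered h).
Proof.
have -> : centered h = (fun x => dotv h (sine_features x) + - dotv h sine_mean).
  by apply/funext => x; exact: centeredE.
by apply: continuous_funD; [exact: continuous_dotv_sine|exact: continuous_funC].
Qed.

Lemma continuous_sine_features (k : 'I_N) :
  continuous (fun x : R => sine_features x ord0 k).
Proof. by under eq_fun do rewrite mxE; exact: continuous_sinM. Qed.

Lemma normr_sine_mean k : `|sine_mean ord0 k| <= 1.
Proof.
have cs := @continuous_sine_features k.
rewrite mxE ler_norml; apply/andP; split.
- rewrite -[leLHS]lg_mean_cst; apply: le_lg_mean => //; first exact: continuous_funC.
  by move=> x; have := normr_sine_features k x; rewrite ler_norml => /andP[].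
- rewrite -[leRHS]lg_mean_cst; apply: le_lg_mean => //; first exact: continuous_funC.
  by move=> x; have := normr_sine_features k x; rewrite ler_norml => /andP[].
Qed.

Lemma normr_centered_le h x : `|centered h x| <= eucl_norm h * (2 * N%:R).
Proof.
apply: le_trans (normr_dotv_le _ _) _; rewrite ler_wpM2l ?eucl_norm_ge0//.
rewrite (@le_trans _ _ (\sum_(k < N) 2))//; last first.
  by rewrite sumr_const card_ord mulr_natr.
apply: ler_sum => k _; rewrite mxE [X in `|_ + X|]mxE.
rewrite (le_trans (ler_normB _ _))// (_ : 2 = 1 + 1)//.
by rewrite lerD ?normr_sine_features ?normr_sine_mean.
Qed.

Lemma lg_mean_centered h : lg_mean (centered h) = 0.
Proof.
rewrite (eq_lg_mean (centeredE h)) lg_meanD; last 2 first.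
- exact: continuous_dotv_sine.
- exact: continuous_funC.
rewrite lg_mean_cst; apply/eqP; rewrite subr_eq0; apply/eqP.
rewrite /lg_mean /dotv; under eq_int01 do rewrite mulr_suml.
rewrite int01_sum; last first.
  move=> k; apply: cfM; apply: continuous_funM; first exact: continuous_funC.
  exact: continuous_sine_features.
apply: eq_bigr => k _; rewrite mxE -lg_meanZ//; exact: continuous_sine_features.
Qed.

(* [lg_mgf h] is the moment generating function of the centred features under
   [theta0]; its logarithm is the Bregman divergence of the log-partition
   function at [theta0]. *)
Definition lg_mgf h : R := lg_mean (fun x => expR (centered h x)).

Definition bregman h : R := ln (lg_mgf h).

Let cexpc h : continuous (fun x => expR (centered h x)).
Proof. by apply: continuous_fun_expR; exact: continuous_centered. Qed.

Lemma lg_mgf_gt0 h : 0 < lg_mgf h.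
Proof.
rewrite (@lt_le_trans _ _ (expR (- (eucl_norm h * (2 * N%:R)))))// ?expR_gt0//.
rewrite -(lg_mean_cst (expR _)); apply: le_lg_mean => //.
- exact: continuous_funC.
- move=> x; rewrite ler_expR lerNl (le_trans (ler_norm _))// normrN.
  exact: normr_centered_le.
Qed.

Lemma expR_bregman h : expR (bregman h) = lg_mgf h.
Proof. by rewrite lnK// posrE lg_mgf_gt0. Qed.

(** Exponential tilting. The partition function at [theta0 + h] is the one at [theta0] times the
    mean of e^(h . Gamma), and centring splits this mean into e^(h . mu) times [lg_mgf h]. *)
Lemma lg_densityD h x :
  lg_density (theta0 + h) x = lg_density theta0 x * expR (centered h x - bregman h).
Proof.
have Z0 := lg_partition_gt0 theta0.
have Zh := lg_partition_gt0 (theta0 + h).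
have mh := lg_mgf_gt0 h.
have ZE : Z (theta0 + h) = Z theta0 * expR (dotv h sine_mean) * lg_mgf h.
  rewrite -mulrA -(lg_meanZ _ (@cexpc h)) /lg_mean -int01Z; last first.
    apply: cfM; apply: continuous_funM => //; exact: continuous_funC.
  apply: eq_int01 => y; rewrite -expRD centeredE subrKC /f0 /lg_density dotvDl expRD.
  rewrite -/(int01 (fun y => expR (dotv theta0 (sine_features y)))).
  rewrite -/(Z theta0); have {}Z0 : Z theta0 != 0 := lt0r_neq0 Z0.
  move: (Z theta0) (expR (dotv theta0 (sine_features y))) Z0 => z a z0.
  by field.
rewrite expRB expR_bregman centeredE expRB /lg_density dotvDl expRD.
rewrite -/(int01 (fun y => expR (dotv theta0 (sine_features y)))).
rewrite -/(int01 (fun y => expR (dotv (theta0 + h) (sine_features y)))).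
rewrite -/(Z theta0) -/(Z (theta0 + h)) ZE.
have em : expR (dotv h sine_mean) != 0 := lt0r_neq0 (expR_gt0 _).
have {}mh : lg_mgf h != 0 := lt0r_neq0 mh.
have {}Z0 : Z theta0 != 0 := lt0r_neq0 Z0.
move: (Z theta0) (lg_mgf h) (expR (dotv h sine_mean)) Z0 mh em.
move: (expR (dotv theta0 (sine_features x))) => a z m e z0 m0 e0.
by field; rewrite z0 m0 e0.
Qed.

(** The form in which convexity and B(0) = 0 are used. The variable e^(centered - B) has mean 1, so
    [expRM_ge] shows that its power t has mean at least 1; this says that [lg_mgf (t *: h)] is at
    least e^(t B(h)). *)
Lemma bregmanZ h t : 1 <= t -> t * bregman h <= bregman (t *: h).
Proof.
move=> t1; have t0 : 0 < t by exact: lt_le_trans t1.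
have cw : continuous (fun x => centered h x - bregman h).
  by apply: continuous_funD; [exact: continuous_centered|exact: continuous_funC].
have ct y : continuous (fun x => y * (centered h x - bregman h)).
  by apply: continuous_funM; [exact: continuous_funC|].
have h1 : 1 <= lg_mean (fun x => expR (t * (centered h x - bregman h))).
  have : lg_mean (fun x => t * expR (centered h x - bregman h) + (1 - t)) <=
         lg_mean (fun x => expR (t * (centered h x - bregman h))).
    apply: le_lg_mean.
    - apply: continuous_funD; last exact: continuous_funC.
      apply: continuous_funM; first exact: continuous_funC.
      exact: continuous_fun_expR.
    - exact: continuous_fun_expR.
    - by move=> x; have := expRM_ge (centered h x - bregman h) t1; lra.
  rewrite lg_meanD; last 2 first.
  - apply: continuous_funM; first exact: continuous_funC.
    exact: continuous_fun_expR.
  - exact: continuous_funC.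
  rewrite lg_meanZ; last exact: continuous_fun_expR.
  rewrite lg_mean_cst.
  have -> : lg_mean (fun x => expR (centered h x - bregman h)) = 1.
    rewrite (@eq_lg_mean _ (fun x => expR (- bregman h) * expR (centered h x))).
      by rewrite lg_meanZ// expRN expR_bregman mulVf// gt_eqF// lg_mgf_gt0.
    by move=> x; rewrite -expRD addrC.
  by lra.
have h2 : lg_mean (fun x => expR (t * (centered h x - bregman h))) =
    expR (- (t * bregman h)) * lg_mgf (t *: h).
  rewrite /lg_mgf -lg_meanZ; last exact: cexpc.
  apply: eq_lg_mean => x; rewrite -expRD; congr expR.
  by rewrite /centered dotvZl; ring.
rewrite -ler_expR expR_bregman.
move: h1; rewrite h2 expRN ler_pdivlMl ?expR_gt0// mulr1//.
Qed.

Lemma lg_density_lower : exists2 l : R, 0 < l & forall x, l <= lg_density theta0 x.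
Proof.
exists (expR (- (eucl_norm theta0 * N%:R)) / Z theta0).
  by rewrite divr_gt0 ?expR_gt0 ?lg_partition_gt0.
move=> x; rewrite /lg_density ler_pM2r ?invr_gt0 ?lg_partition_gt0//.
rewrite ler_expR lerNl (le_trans (ler_norm _))// normrN.
exact: normr_dotv_sine_le.
Qed.

(** The density is bounded below, so the model mean dominates a multiple of the Lebesgue integral.
    Centring subtracts h . mu, which is why [int01_sine_L1_ge] has to be uniform in an additive
    constant. *)
Lemma lg_mean_norm_centered_ge : exists2 k : R, 0 < k & forall h,
  k * eucl_norm h <= lg_mean (fun x => `|centered h x|).
Proof.
have [k k0 hk] := @int01_sine_L1_ge R N.
have [l l0 hl] := lg_density_lower.
exists (l * k); first exact: mulr_gt0.
move=> h; rewrite -mulrA.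
have cn : continuous (fun x => `|centered h x|).
  by apply: continuous_fun_norm; exact: continuous_centered.
apply: (@le_trans _ _ (l * int01 (fun x => `|centered h x|))).
  rewrite ler_pM2l//; apply: le_trans (hk h (- dotv h sine_mean)) _.
  rewrite le_eqVlt; apply/orP; left; apply/eqP.
  by apply: eq_int01 => x; rewrite -centeredE.
rewrite -int01Z//; apply: le_int01.
- by apply: continuous_funM; [exact: continuous_funC|].
- exact: cfM.
- by move=> x; rewrite mulrC ler_wpM2l.
Qed.

Lemma bregman_lower : exists2 c : R, 0 < c & forall h,
  c * Num.min (eucl_norm h ^+ 2) (eucl_norm h) <= bregman h.
Proof.
have [k k0 hk] := lg_mean_norm_centered_ge.
have mgf_ge h : 1 + k ^+ 2 / 16 * eucl_norm h ^+ 2 <= lg_mgf h.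
  (* This value maximizes a k |h| - a^2. In [expR_ge_norm] the terms linear in x have mean zero and
     |x| has mean at least k |h| = 2 a, which leaves 1 + a^2 / 4. *)
  pose a := k * eucl_norm h / 2.
  have a0 : 0 <= a by rewrite divr_ge0// mulr_ge0 ?eucl_norm_ge0// ltW.
  have ch := @continuous_centered h.
  have cn : continuous (fun x => `|centered h x|) by exact: continuous_fun_norm.
  have cZ f y : continuous f -> continuous (fun x => y * f x : R).
    by move=> cf; apply: continuous_funM; [exact: continuous_funC|].
  have cK (y : R) : continuous (fun _ : R => y) by exact: continuous_funC.
  have : lg_mean (fun x => (1 - a ^+ 2 / 4) +
      ((1 + a / 4) * centered h x + a / 4 * `|centered h x|)) <= lg_mgf h.
    apply: le_lg_mean => //.
    - by apply: continuous_funD => //; apply: continuous_funD; exact: cZ.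
    - by move=> x; have := expR_ge_norm (centered h x) a; lra.
  rewrite lg_meanD//; last by apply: continuous_funD; exact: cZ.
  rewrite lg_mean_cst lg_meanD; [|exact: cZ..].
  rewrite !lg_meanZ// lg_mean_centered mulr0 add0r.
  apply: le_trans.
  have := ler_wpM2l (_ : 0 <= a / 4) (hk h); rewrite divr_ge0// => /(_ isT).
  rewrite /a; lra.
pose k' := k ^+ 2 / 16.
have k'0 : 0 < k' by rewrite divr_gt0// exprn_gt0.
(* From ln (1 + y) >= y / (1 + y) with y = k' |h|^2 <= k' on the unit ball. *)
pose c := k' / (1 + k').
have c0 : 0 < c by rewrite divr_gt0// addr_gt0.
have small h : eucl_norm h <= 1 -> c * eucl_norm h ^+ 2 <= bregman h.
  move=> h1; set s := eucl_norm h ^+ 2.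
  have s0 : 0 <= s by exact: sqr_ge0.
  have s1 : s <= 1 by rewrite /s expr_le1// eucl_norm_ge0.
  have ks0 : 0 < 1 + k' * s by rewrite ltr_pwDl// mulr_ge0// ltW.
  have h2 : - bregman h <= - (k' * s / (1 + k' * s)).
    rewrite (_ : - (_ / _) = (1 + k' * s)^-1 - 1); last first.
      by field; rewrite gt_eqF.
    have := expR_ge1Dx (- bregman h); rewrite expRN expR_bregman.
    have : (lg_mgf h)^-1 <= (1 + k' * s)^-1.
      by rewrite lef_pV2 ?posrE ?lg_mgf_gt0//; exact: mgf_ge.
    lra.
  rewrite -[leRHS]opprK lerNr (le_trans h2)// lerN2.
  rewrite /c mulrAC; apply: ler_wpM2l; first by rewrite mulr_ge0// ltW.
  have k1 : 0 < 1 + k' by rewrite addr_gt0.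
  by rewrite (lef_pV2 k1 ks0) lerD2l ler_piMr// ltW.
exists c => // h; have [h1|h1] := leP (eucl_norm h) 1.
  apply: le_trans (small h h1); rewrite ler_pM2l//.
  by rewrite ge_min lexx.
(* Outside the unit ball, [bregmanZ] extends the bound on the unit sphere linearly along the ray. *)
set s := eucl_norm h in h1 *.
have s0 : 0 < s by exact: lt_trans h1.
have hn : eucl_norm (s^-1 *: h) = 1.
  by rewrite eucl_normZ ger0_norm ?invr_ge0 ?ltW// -/s mulVf// gt_eqF.
have sh : s *: (s^-1 *: h) = h by rewrite scalerA (mulfV (lt0r_neq0 s0)) scale1r.
have := small (s^-1 *: h); rewrite hn => /(_ (lexx _)); rewrite expr1n mulr1 => cb.
have := @bregmanZ (s^-1 *: h) s (ltW h1).
rewrite sh => hb.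
have h2 : s * c <= s * bregman (s^-1 *: h) := ler_wpM2l (ltW s0) cb.
apply: (le_trans _ (le_trans h2 hb)).
by rewrite mulrC; apply: ler_wpM2r; [exact: (ltW c0)|rewrite ge_min lexx orbT].
Qed.

End logistic_model.

(** * Moments of the sample *)

Section independence.
Context {R : realType} {d : measure_display} {Omega : measurableType d}.
Variable P : probability Omega R.
Variable xi : nat -> {RV P >-> R}.
Hypothesis xi_indep : mutually_independent xi.

Let event (J : {fset nat}) (B : nat -> set R) : set Omega :=
  \bigcap_(i in [set` J]) xi i @^-1` B i.

Let measurable_event J B : (forall i, measurable (B i)) -> measurable (event J B).
Proof.
move=> mB; apply: fin_bigcap_measurable; first exact: finite_fset.
by move=> i _; exact: measurable_preimageT.
Qed.

Let event1 J B k A : k \notin J ->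
  event (k |` J)%fset (fun i => if i == k then A else B i) =
  xi k @^-1` A `&` event J B.
Proof.
move=> kJ; apply/seteqP; split => [w Ew|w [Aw Ew] i /=].
  split; first by have := Ew k; rewrite /= eqxx; apply; rewrite !inE eqxx.
  move=> i iJ; have := Ew i; rewrite /= ifN.
    by apply; rewrite /= !inE; apply/orP; right.
  by apply: contraNneq kJ => <-.
rewrite !inE; have [->//|_ /= iJ] := eqVneq i k.
exact: Ew.
Qed.

Let event1_prob J B k A : k \notin J -> (forall i, measurable (B i)) -> measurable A ->
  P (xi k @^-1` A `&` event J B) = (P (xi k @^-1` A) * P (event J B))%E.
Proof.
move=> kJ mB mA; rewrite -event1//.
have mB' i : measurable (if i == k then A else B i) by case: ifP.
rewrite /event !xi_indep// big_fsetU1//= eqxx; congr (_ * _)%E.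
apply: eq_big_seq => i iJ; rewrite ifN//.
by apply: contraNneq kJ => <-.
Qed.

(* The events involving the remaining variables are what makes the induction
   on [n] go through. *)
Let integral_prod_event (g : R -> R) (c : R) n (J : {fset nat}) (B : nat -> set R) :
  measurable_fun setT g -> (forall x, 0 <= g x) ->
  (forall i, \int[P]_w (g (xi i w))%:E = c%:E)%E ->
  (forall i, i \in J -> (n <= i)%N) -> (forall i, measurable (B i)) ->
  (\int[P]_(w in event J B) (\prod_(i < n) g (xi i w))%:E =
   (c ^+ n)%:E * P (event J B))%E.
Proof.
move=> mg g0 gc.
have mgxi i : measurable_fun setT (fun w => g (xi i w)) by exact: measurableT_comp.
have c0 : 0 <= c.
  by rewrite -lee_fin -(gc 0); apply: integral_ge0 => w _; rewrite lee_fin.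
elim: n J B => [|n IH] J B Jn mB.
  rewrite expr0; under eq_integral do rewrite big_ord0.
  by rewrite integral_cst//; exact: measurable_event.
have mE : measurable (event J B) by exact: measurable_event.
pose p := fine (P (event J B)).
have PE : P (event J B) = p%:E by rewrite fineK// fin_num_measure.
have p0 : 0 <= p by rewrite fine_ge0.
have nJ : n \notin J by apply/negP => /Jn; rewrite ltnn.
pose w1 w := (\prod_(i < n) g (xi i w)) * \1_(event J B) w.
have mw1 : measurable_fun setT w1.
  by apply: measurable_funM => //; exact: measurable_prod.
have w10 w : 0 <= w1 w by rewrite mulr_ge0// prodr_ge0.
(* On events {[xi n] in A}, the weight [w1] has the same integral as a constant: this is the
   induction hypothesis with index n added to the set of constrained variables. Integral transfer
   then replaces [w1] by that constant under any nonnegative measurable function of [xi n], in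
   particular [g]. *)
have step A : measurable A ->
    (\int[P]_(w in xi n @^-1` A) (w1 w)%:E =
     \int[P]_(w in xi n @^-1` A) (c ^+ n * p)%:E)%E.
  move=> mA; have mxA : measurable (xi n @^-1` A) by exact: measurable_preimageT.
  rewrite [RHS](integral_cst P mxA (c ^+ n * p)%:E).
  have -> : (\int[P]_(w in xi n @^-1` A) (w1 w)%:E =
      \int[P]_(w in xi n @^-1` A `&` event J B) (\prod_(i < n) g (xi i w))%:E)%E.
    rewrite [RHS]integral_mkcondr; apply: eq_integral => w _.
    by rewrite /w1 restrict_EFin/= patchE indicE; case: ifP => _; rewrite ?mulr1 ?mulr0.
  rewrite -event1// IH.
  - by rewrite event1// event1_prob// PE muleCA muleC EFinM muleAC.
  - by move=> i; rewrite !inE => /orP[/eqP ->//|/Jn /ltnW].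
  - by move=> i; case: ifP.
have H : (\int[P]_w ((EFin \o g) (xi n w) * (w1 w)%:E) =
    \int[P]_w ((EFin \o g) (xi n w) * (c ^+ n * p)%:E))%E.
  apply: (eq_integral_transfer _ _ mw1 _ w10 _ step) => //.
  - by move=> _; rewrite mulr_ge0// exprn_ge0.
  - exact/measurable_EFinP.
transitivity (\int[P]_w (((EFin \o g) (xi n w)) * (w1 w)%:E))%E.
  rewrite integral_mkcond; apply: eq_integral => w _.
  rewrite restrict_EFin/= patchE /w1 indicE -EFinM big_ord_recr/=; congr EFin.
  by case: ifP => _; rewrite ?mulr1 ?mulr0// mulrC.
rewrite H.
rewrite ge0_integralZr ?lee_fin ?mulr_ge0 ?exprn_ge0//; last 2 first.
- exact/measurable_EFinP.
- by move=> w _; rewrite lee_fin.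
by rewrite /= gc PE exprSr -!EFinM mulrCA mulrA.
Qed.

Lemma integral_prod_indep (g : R -> R) (c : R) n :
  measurable_fun setT g -> (forall x, 0 <= g x) ->
  (forall i, \int[P]_w (g (xi i w))%:E = c%:E)%E ->
  (\int[P]_w (\prod_(i < n) g (xi i w))%:E = (c ^+ n)%:E)%E.
Proof.
move=> mg g0 gc.
have E0 : event fset0 (fun=> setT) = setT.
  by apply/seteqP; split => // w _ i; rewrite /= inE.
have := @integral_prod_event g c n fset0 (fun=> setT) mg g0 gc.
by rewrite E0 probability_setT mule1; apply => // i; rewrite inE.
Qed.

End independence.

(** * Fourth moments of the normalized feature sums, through exponential moments *)

Section fourth_moment.
Context {R : realType} {N : nat} {d : measure_display}.
Context {Omega : measurableType d} (P : probability Omega R).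
Variables (theta0 : 'rV[R]_N) (xi : nat -> {RV P >-> R}).
Hypothesis hxi : iid_lg theta0 xi.

Lemma integral_iid_lg (g : R -> R) i : continuous g -> (forall x, 0 <= g x) ->
  (\int[P]_w (g (xi i w))%:E = (lg_mean theta0 g)%:E)%E.
Proof.
move=> cg g0; have [_ law] := hxi.
have mg : measurable_fun setT g by exact: continuous_measurable_fun.
have mf : measurable_fun setT (lg_density theta0).
  by apply: continuous_measurable_fun; exact: continuous_lg_density.
pose w2 := (lg_density theta0) \_ `[0, 1]%classic.
have mw2 : measurable_fun setT w2.
  by apply/(measurable_restrictT _ _).1 => //; exact: measurable_funTS.
have w20 x : 0 <= w2 x.
  by rewrite /w2 patchE; case: ifP => // _; rewrite ltW// lg_density_gt0.
transitivity (\int[P]_w ((g (xi i w))%:E * (cst 1 w)%:E))%E.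
  by apply: eq_integral => w _; rewrite mule1.
have step A : measurable A ->
    (\int[P]_(w in xi i @^-1` A) (cst 1 w)%:E =
     \int[lebesgue_measure]_(x in id @^-1` A) (w2 x)%:E)%E.
  move=> mA; have mxA : measurable (xi i @^-1` A) by exact: measurable_preimageT.
  rewrite [LHS](integral_cst P mxA 1%:E) mul1e.
  apply: (etrans (law i A mA)).
  rewrite integral_mkcondr; apply: eq_integral => x _.
  by rewrite /w2 restrict_EFin.
have -> : (\int[P]_w ((g (xi i w))%:E * (cst 1 w)%:E) =
    \int[lebesgue_measure]_x ((EFin \o g) x * (w2 x)%:E))%E.
  apply: (@eq_integral_transfer _ _ _ _ (measurableTypeR R) (measurableTypeR R) R P
    lebesgue_measure (xi i) id (cst 1) w2 (EFin \o g)) => //.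
  exact: (@measurable_funPT _ _ _ _ (xi i)).
  exact/measurable_EFinP.
rewrite /lg_mean /int01 /Rintegral fineK; last first.
  apply: integrable_fin_num => //; apply: int01_integrable.
  by apply: continuous_funM => //; exact: continuous_lg_density.
rewrite [RHS]integral_mkcond; apply: eq_integral => x _.
rewrite restrict_EFin/= -EFinM /w2 !patchE; congr EFin.
by case: ifP => // _; rewrite mulr0.
Qed.

(** For |z| <= 1/2 one has e^z <= 1 + z + 2 z^2, because (1 + z + 2 z^2) (1 - z) = 1 + z^2 (1 - 2 z)
    >= 1 >= e^z (1 - z). Here z is [l] times a centred coordinate bounded by 2, so |l| <= 1/4 is
    what is needed; the linear term has mean zero and 2 z^2 <= 8 l^2. *)
Lemma lg_exp_moment (k : 'I_N) (l : R) : `|l| <= 4^-1 ->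
  lg_mean theta0 (fun x => expR (l * (sine_features x ord0 k - sine_mean theta0 ord0 k)))
  <= 1 + 8 * l ^+ 2.
Proof.
move=> l4.
pose y x := sine_features x ord0 k - sine_mean theta0 ord0 k.
have yE : y = centered theta0 (delta_mx ord0 k).
  apply/funext => x; rewrite /centered /dotv (bigD1 k)//= big1 => [|j jk].
    by rewrite mxE !eqxx mul1r addr0 mxE [X in _ = _ + X]mxE.
  by rewrite mxE eqxx/= (negbTE jk) mul0r.
have cy : continuous y by rewrite yE; exact: continuous_centered.
have cK (c : R) : continuous (fun _ : R => c) by exact: continuous_funC.
have cly : continuous (fun x => l * y x) by exact: continuous_funM.
have y2 x : `|y x| <= 2.
  rewrite (le_trans (ler_normB _ _))// (_ : 2 = 1 + 1)//.
  by rewrite lerD ?normr_sine_features ?normr_sine_mean.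
have : lg_mean theta0 (fun x => expR (l * y x)) <=
       lg_mean theta0 (fun x => 1 + 8 * l ^+ 2 + l * y x).
  apply: le_lg_mean; [exact: continuous_fun_expR|exact: continuous_funD|].
  move=> x; set z := l * y x.
  have z1 : `|z| <= 2^-1.
    rewrite normrM (_ : 2^-1 = 4^-1 * 2); last by field.
    exact: ler_pM.
  have zl : z ^+ 2 <= 4 * l ^+ 2.
    rewrite /z exprMn mulrC ler_wpM2r ?sqr_ge0//.
    rewrite -(real_normK (num_real (y x))).
    by have := y2 x; have := normr_ge0 (y x); nra.
  have zz : expR z * (1 - z) <= 1.
    rewrite -[leRHS](expR0 R) -(subrr z) expRD ler_wpM2l ?expR_ge0//.
    exact: expR_ge1Dx.
  have [zlo zhi] : - 2^-1 <= z /\ z <= 2^-1 by move: z1; rewrite ler_norml => /andP.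
  have e0 := expR_ge0 z.
  have h : 1 <= (1 + z + 2 * z ^+ 2) * (1 - z).
    have := mulr_ge0 (sqr_ge0 z) (_ : 0 <= 1 - 2 * z); rewrite subr_ge0; nra.
  have z0 : 0 < 1 - z by lra.
  have := le_trans zz h; rewrite ler_pM2r//; lra.
have Ey : lg_mean theta0 y = 0 by rewrite yE lg_mean_centered.
by rewrite (lg_meanD _ (cK _) cly) lg_mean_cst (lg_meanZ _ _ cy) Ey mulr0 addr0.
Qed.

Definition deviation (n : nat) (w : Omega) (k : 'I_N) : R :=
  \sum_(i < n) (sine_features (xi i w) ord0 k - sine_mean theta0 ord0 k).

(** The scale is at most 1/4 for all n >= 1, as [lg_exp_moment] requires, and 8 [rate]^2 = 1 / (2
    n), so the product of n factors is at most e^(1/2). *)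
Let rate (n : nat) : R := (4 * Num.sqrt n%:R)^-1.

Let deviation_mgf n (k : 'I_N) (s : R) : (0 < n)%N -> `|s| = 1 ->
  (\int[P]_w (expR (s * rate n * deviation n w k))%:E <= (expR 1)%:E)%E.
Proof.
move=> n0 s1.
have q1 : 1 <= Num.sqrt n%:R :> R by rewrite -[leLHS]sqrtr1 ler_wsqrtr// ler1n.
have q2 : Num.sqrt n%:R ^+ 2 = n%:R :> R by rewrite sqr_sqrtr// ler0n.
have q0 : 0 < Num.sqrt n%:R :> R by lra.
pose g x := expR (s * rate n * (sine_features x ord0 k - sine_mean theta0 ord0 k)).
have cg : continuous g.
  apply: continuous_fun_expR; apply: continuous_funM; first exact: continuous_funC.
  by apply: continuous_funD; [exact: continuous_sine_features|exact: continuous_funC].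
have g0 x : 0 <= g x by exact: expR_ge0.
have mg : measurable_fun setT g by exact: continuous_measurable_fun.
have gc i := @integral_iid_lg g i cg g0.
have -> : (\int[P]_w (expR (s * rate n * deviation n w k))%:E =
    \int[P]_w (\prod_(i < n) g (xi i w))%:E)%E.
  by apply: eq_integral => w _; rewrite /deviation mulr_sumr expR_sum.
rewrite (integral_prod_indep (proj1 hxi) n mg g0 gc) lee_fin.
have sr : `|s * rate n| <= 4^-1.
  rewrite normrM s1 mul1r ger0_norm ?invr_ge0 ?mulr_ge0 ?sqrtr_ge0//.
  rewrite lef_pV2 ?posrE//; lra.
have : lg_mean theta0 g <= 1 + (2 * n%:R)^-1.
  apply: le_trans (lg_exp_moment k sr) _.
  rewrite lerD2l exprMn -(real_normK (num_real s)) s1 expr1n mul1r /rate exprVn exprMn q2.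
  rewrite le_eqVlt; apply/orP; left; apply/eqP; field.
  by rewrite pnatr_eq0 -lt0n.
move=> h; have gm0 : 0 <= lg_mean theta0 g.
  by rewrite -(@lg_mean_cst _ _ theta0 0); apply: le_lg_mean => //; exact: continuous_funC.
have h' : lg_mean theta0 g <= expR ((2 * n%:R)^-1).
  exact: le_trans h (expR_ge1Dx _).
apply: (@le_trans _ _ (expR ((2 * n%:R)^-1) ^+ n)).
  by rewrite lerXn2r ?nnegrE ?expR_ge0.
rewrite -expRM_natl ler_expR.
have n0' : n%:R != 0 :> R by rewrite pnatr_eq0 -lt0n.
rewrite invfM mulrCA mulfV// mulr1; lra.
Qed.

(** For x >= 0 this is y <= e^y at y = x / 4, raised to the fourth power; the second exponential
    covers negative x. *)
Lemma expr4_le_expR (x : R) : x ^+ 4 <= 4 ^+ 4 * (expR x + expR (- x)).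
Proof.
wlog x0 : x / 0 <= x => [th|].
  have [|/ltW x0] := leP 0 x; first exact: th.
  rewrite (_ : x ^+ 4 = (- x) ^+ 4); last by ring.
  have h := th (- x); rewrite opprK in h.
  by rewrite addrC; apply: h; rewrite oppr_ge0.
have h : (x / 4) ^+ 4 <= expR (x / 4) ^+ 4.
  rewrite lerXn2r ?nnegrE ?expR_ge0 ?divr_ge0//.
  by have := expR_ge1Dx (x / 4); lra.
have e0 := expR_ge0 (- x).
rewrite -expRM_natl (_ : 4%:R * (x / 4) = x) in h; last by field.
rewrite -[in leLHS](divfK (_ : 4 != 0 :> R) x)// exprMn mulrC.
by rewrite ler_wpM2l// (le_trans h)// lerDl.
Qed.

Lemma measurable_deviation n k : measurable_fun setT (fun w => deviation n w k).
Proof.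
apply: measurable_sum => i; apply: measurable_funB => //.
have ms : measurable_fun setT (fun x : R => sine_features x ord0 k : R).
  by apply: continuous_measurable_fun; exact: continuous_sine_features.
exact: (measurableT_comp ms (@measurable_funPT _ _ _ _ (xi i))).
Qed.

Lemma deviation_fourth_moment : exists2 K : R, 0 <= K & forall n k, (0 < n)%N ->
  (\int[P]_w ((deviation n w k / Num.sqrt n%:R) ^+ 4)%:E <= K%:E)%E.
Proof.
have [c [cE c0]] : exists c : R, c = 4 ^+ 4 /\ 0 < c.
  by exists (4 ^+ 4); rewrite exprn_gt0.
have c_ge x : x ^+ 4 <= c * (expR x + expR (- x)) by rewrite cE expr4_le_expR.
(* One factor 4^4 comes from [expr4_le_expR], the other from the deviation over sqrt n being 4 times
   [rate n] times the deviation. The two exponentials are the bounds for the signs s = 1 and s =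
   -1. *)
exists (c * (c * (expR 1 + expR 1))).
  by rewrite !mulr_ge0 ?(ltW c0)// addr_ge0// expR_ge0.
move=> n k n0.
have q0 : 0 < Num.sqrt n%:R :> R by rewrite sqrtr_gt0 ltr0n.
have md := measurable_deviation n k.
have me s : measurable_fun setT (fun w => (expR (s * rate n * deviation n w k))%:E).
  apply/measurable_EFinP; apply: measurableT_comp => //.
  exact: measurable_funM.
pose F w := ((c * c)%:E * ((expR (1 * rate n * deviation n w k))%:E +
    (expR (-1 * rate n * deviation n w k))%:E))%E.
apply: (@le_trans _ _ (\int[P]_w F w)%E).
  apply: ge0_le_integral => //.
  - by move=> w _; rewrite lee_fin exprn_even_ge0.
  - apply/measurable_EFinP; apply: measurable_funX; exact: measurable_funM.
  - by apply: measurable_funeM; exact: emeasurable_funD.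
  - move=> w _; rewrite /F -EFinD -EFinM lee_fin mul1r mulN1r mulNr.
    have -> : deviation n w k / Num.sqrt n%:R = 4 * (rate n * deviation n w k).
      by rewrite /rate; field; rewrite gt_eqF.
    move: (rate n * deviation n w k) => x.
    by rewrite exprMn -cE -mulrA ler_pM2l.
rewrite /F ge0_integralZl//; last 3 first.
- by apply: emeasurable_funD; exact: me.
- by move=> w _; rewrite adde_ge0// lee_fin expR_ge0.
- by rewrite lee_fin mulr_ge0// ltW.
rewrite mulrA [leRHS]EFinM; apply: lee_wpmul2l; first by rewrite lee_fin mulr_ge0// ltW.
rewrite ge0_integralD//; try by move=> w _; rewrite lee_fin expR_ge0.
by rewrite EFinD leeD// deviation_mgf ?normrN ?normr1.
Qed.

End fourth_moment.

(** * Second moment of the posterior *)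

Lemma integral_gt0 d (T : measurableType d) (R : realType)
  (mu : {measure set T -> \bar R}) (D : set T) (f : T -> \bar R) :
  measurable D -> measurable_fun D f -> (forall x, D x -> 0 < f x)%E ->
  mu D != 0%E -> (0 < \int[mu]_(x in D) f x)%E.
Proof.
move=> mD mf f0 muD.
rewrite lt_neqAle; apply/andP; split; last first.
  by apply: integral_ge0 => x Dx; exact: ltW (f0 _ Dx).
apply: contra muD => /eqP/esym If0.
have : (\int[mu]_(x in D) `|f x| = 0)%E.
  rewrite -If0; apply: eq_integral => x; rewrite inE => Dx.
  by rewrite gee0_abs// ltW// f0.
move/(ae_eq_integral_abs mu mD mf) => [A [mA A0 DA]].
apply/eqP; apply: (subset_measure0 mD mA _ A0).
move=> x Dx; apply: DA => /= /(_ Dx) fx0.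
by have := f0 _ Dx; rewrite fx0 ltxx.
Qed.

Section posterior_moments.
Context {R : realType} {N : nat}.
Variables (prior : probability 'rV[R]_N R) (a : 'rV[R]_N).
Variables (L m c : R).
Hypotheses (L0 : 0 <= L) (m0 : 0 < m) (c0 : 0 < c).
Hypothesis doubling : forall F : 'rV[R]_N -> \bar R,
  measurable_fun setT F -> (forall v, 0 <= F v)%E ->
  (\int[prior]_v F v <= (2 ^+ N)%:E * \int[prior]_v (F (2 *: v - a)%R *
    (expR (L * eucl_norm (v - a) - m * eucl_norm (v - a) ^+ 2))%:E))%E.
Variable B : 'rV[R]_N -> R.
Hypothesis B_lower : forall h, c * Num.min (eucl_norm h ^+ 2) (eucl_norm h) <= B h.
Hypothesis B_double : forall h, 2 * B h <= B (2 *: h).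
Variables (n : nat) (G : 'rV[R]_N) (lik : 'rV[R]_N -> R).
Hypothesis lik_gt0 : forall v, 0 < lik v.
Hypothesis measurable_lik : measurable_fun setT lik.
Hypothesis likD : forall h, lik (a + h) = lik a * expR (dotv h G - n%:R * B h).

(** The quantity A of the overview. The l^1 norm of [G] bounds h . G by a multiple of |h| and leaves
    coordinatewise sums, which are what the moment bounds handle. *)
Definition slope : R := L + \sum_k `|G ord0 k|.

Let slope_ge0 : 0 <= slope. Proof. by rewrite addr_ge0// sumr_ge0. Qed.

Let B_ge0 h : 0 <= B h.
Proof.
apply: le_trans (B_lower h); rewrite mulr_ge0 ?(ltW c0)// le_min.
by rewrite sqr_ge0 eucl_norm_ge0.
Qed.

Let dotG_le h : dotv h G <= eucl_norm h * \sum_k `|G ord0 k|.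
Proof. exact: le_trans (ler_norm _) (normr_dotv_le _ _). Qed.

Let doubleE (v : 'rV[R]_N) : 2 *: v - a = a + 2 *: (v - a).
Proof.
by apply/rowP => i; rewrite !mxE; ring.
Qed.

Let measurable_dist : measurable_fun setT (fun v : 'rV[R]_N => eucl_norm (v - a)).
Proof. exact: measurable_eucl_dist. Qed.

Let measurable_double : measurable_fun setT (fun v : 'rV[R]_N => 2 *: v - a).
Proof.
apply/measurable_fun_rVP => i; under eq_fun do rewrite !mxE.
by apply: measurable_funB => //; apply: measurable_funM => //; exact: measurable_coord_rV.
Qed.

Let weight (v : 'rV[R]_N) : R :=
  expR (L * eucl_norm (v - a) - m * eucl_norm (v - a) ^+ 2).

Let measurable_weight : measurable_fun setT weight.
Proof.
apply: measurableT_comp => //; apply: measurable_funB; apply: measurable_funM => //.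
exact: measurable_funX.
Qed.

Definition mass : \bar R := (\int[prior]_v (lik v)%:E)%E.

Definition moment2 : \bar R :=
  (\int[prior]_v (eucl_norm (v - a) ^+ 2 * lik v)%:E)%E.

Lemma mass_gt0 : (0 < mass)%E.
Proof.
apply: integral_gt0 => //; first exact/measurable_EFinP.
- by move=> v _; rewrite lte_fin.
- by rewrite [X in X != _]probability_setT onee_neq0.
Qed.

(** After doubling, the integrand is at most lik(a) exp(2 A s - m s^2) with s = |v - a|, and
    completing the square bounds the exponent by A^2 / m. *)
Lemma mass_lty : (mass < +oo)%E.
Proof.
pose K := lik a * expR (slope ^+ 2 / m).
have K0 : 0 <= K by rewrite mulr_ge0 ?expR_ge0// ltW.
have mlik : measurable_fun setT (EFin \o lik) by exact/measurable_EFinP.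
apply: (@le_lt_trans _ _ ((2 ^+ N)%:E * K%:E)%E); last by rewrite -EFinM ltry.
have := @doubling (EFin \o lik) mlik.
move=> /(_ (fun v => _)) h; apply: le_trans (h _) _.
  by move=> v; rewrite lee_fin ltW.
apply: lee_wpmul2l; first by rewrite lee_fin exprn_ge0.
rewrite -[leRHS]mule1 -(@probability_setT _ _ _ prior).
rewrite -(integral_cst prior measurableT K%:E).
apply: ge0_le_integral => //.
- by move=> v _; rewrite mule_ge0// lee_fin ?expR_ge0 ?ltW.
- apply: emeasurable_funM; first exact: measurableT_comp mlik measurable_double.
  exact/measurable_EFinP.
- move=> v _; rewrite /= -EFinM lee_fin doubleE likD /K -mulrA ler_pM2l//.
  rewrite -expRD ler_expR.
  set u := v - a.
  have h1 := dotG_le (2 *: u); rewrite eucl_normZ ger0_norm// in h1.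
  have h2 : 0 <= n%:R * B (2 *: u) by rewrite mulr_ge0 ?ler0n.
  have h3 : 2 * eucl_norm u * slope - m * eucl_norm u ^+ 2 <= slope ^+ 2 / m.
    rewrite ler_pdivlMr//; have := sqr_ge0 (m * eucl_norm u - slope); lra.
  have h4 : L * eucl_norm u + 2 * eucl_norm u * (\sum_k `|G ord0 k|) <=
      2 * eucl_norm u * slope.
    rewrite /slope; have := mulr_ge0 L0 (eucl_norm_ge0 u); lra.
  lra.
Qed.

(** The term [r ^+ 2] pays for the ball of radius r. Outside it, [doubling] is applied to the
    truncated integrand: [2 ^+ N] is the Jacobian, 4 comes from |2 u|^2, and [S] bounds |u|^2 times
    the surplus factor uniformly. *)
Lemma moment2_split (r S : R) : 0 <= r -> 0 <= S ->
  (forall u : 'rV[R]_N, r < 2 * eucl_norm u ->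
    eucl_norm u ^+ 2 *
      expR (slope * eucl_norm u - n%:R * B u - m * eucl_norm u ^+ 2) <= S) ->
  (moment2 <= (r ^+ 2 + 2 ^+ N * 4 * S)%:E * mass)%E.
Proof.
move=> r0 S0 HS.
pose f v := eucl_norm (v - a) ^+ 2 * lik v.
pose F v := if r < eucl_norm (v - a) then f v else 0.
have f0 v : 0 <= f v by rewrite mulr_ge0 ?sqr_ge0// ltW.
have F0 v : 0 <= F v by rewrite /F; case: ifP.
have mf : measurable_fun setT f.
  by apply: measurable_funM => //; exact: measurable_funX.
have mF : measurable_fun setT F.
  apply: measurable_fun_ifT => //.
  by apply: measurable_fun_ltr => //; exact: measurable_cst.
have mEF : measurable_fun setT (EFin \o F) by exact/measurable_EFinP.
have mElik : measurable_fun setT (EFin \o lik) by exact/measurable_EFinP.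
have lik0 v : (0 <= (EFin \o lik) v)%E by rewrite lee_fin ltW.
have EF0 v : (0 <= (EFin \o F) v)%E by rewrite lee_fin.
have step1 : (moment2 <= (r ^+ 2)%:E * mass + \int[prior]_v (EFin \o F) v)%E.
  have r20 : (0 <= (r ^+ 2)%:E)%E by rewrite lee_fin sqr_ge0.
  rewrite /mass -(ge0_integralZl prior measurableT mElik (fun v _ => lik0 v) r20).
  rewrite -ge0_integralD//; last 2 first.
  - by move=> v _; rewrite mule_ge0.
  - exact: measurable_funeM.
  apply: ge0_le_integral => //.
  - by move=> v _; rewrite lee_fin f0.
  - exact/measurable_EFinP.
  - by apply: emeasurable_funD => //; exact: measurable_funeM.
  - move=> v _; rewrite /= -EFinM -EFinD lee_fin /F -/(f v).
    case: ltP => [_|vr]; first by rewrite lerDr mulr_ge0 ?sqr_ge0// ltW.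
    rewrite addr0 /f ler_pM2r// lerXn2r ?nnegrE ?eucl_norm_ge0//.
apply: le_trans step1 _; rewrite EFinD ge0_muleDl ?lee_fin ?sqr_ge0//; last first.
  by rewrite !mulr_ge0 ?exprn_ge0.
rewrite leeD2l//; apply: le_trans (doubling mEF EF0) _.
rewrite -mulrA EFinM -muleA; apply: lee_wpmul2l; first by rewrite lee_fin exprn_ge0.
have S40 : (0 <= (4 * S)%:E)%E by rewrite lee_fin mulr_ge0.
rewrite /mass -(ge0_integralZl prior measurableT mElik (fun v _ => lik0 v) S40).
apply: ge0_le_integral => //.
- by move=> v _; rewrite mule_ge0// lee_fin expR_ge0.
- apply: emeasurable_funM; first exact: measurableT_comp mEF measurable_double.
  exact/measurable_EFinP.
- exact: measurable_funeM.
- move=> v _; rewrite /= -!EFinM lee_fin /F.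
  have -> : 2 *: v - a - a = 2 *: (v - a) by rewrite doubleE addrAC subrr add0r.
  have vE : v = a + (v - a) by rewrite subrKC.
  rewrite /f doubleE [in lik v]vE; set u := v - a.
  have -> : a + 2 *: u - a = 2 *: u by rewrite addrAC subrr add0r.
  rewrite eucl_normZ ger0_norm//.
  case: ltP => [ru|_]; last by rewrite mul0r !mulr_ge0// ltW.
  rewrite !likD dotvZl exprMn.
  have := HS u ru; set s := eucl_norm u => hs.
  have s0 : 0 <= s by exact: eucl_norm_ge0.
  (* At 2 u the likelihood ratio is at most e^e squared: one factor rebuilds the likelihood at
     [a + u], hence the mass, and the other is absorbed into [S] together with the prior weight. *)
  pose e := dotv u G - n%:R * B u.
  have h1 : expR (2 * dotv u G - n%:R * B (2 *: u)) <= expR e * expR e.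
    rewrite -expRD ler_expR /e.
    have := ler_wpM2l (ler0n R n) (B_double u); lra.
  have h2 : expR e * expR (L * s - m * s ^+ 2) <=
      expR (slope * s - n%:R * B u - m * s ^+ 2).
    by rewrite -expRD ler_expR /e /slope; have := dotG_le u; rewrite -/s; lra.
  apply: (@le_trans _ _ (4 * s ^+ 2 * (lik a * (expR e * expR e)) *
      expR (L * s - m * s ^+ 2))).
    rewrite ler_wpM2r ?expR_ge0// (_ : 2 ^+ 2 = 4 :> R); last by ring.
    by rewrite ler_wpM2l ?mulr_ge0 ?sqr_ge0// ler_wpM2l// ltW.
  rewrite (_ : 4 * s ^+ 2 * (lik a * (expR e * expR e)) * expR (L * s - m * s ^+ 2) =
    4 * (lik a * expR e) * (s ^+ 2 * (expR e * expR (L * s - m * s ^+ 2)))); last by ring.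
  rewrite (_ : 4 * S * (lik a * expR e) = 4 * (lik a * expR e) * S); last by ring.
  apply: ler_wpM2l; first by rewrite !mulr_ge0 ?expR_ge0// ltW.
  apply: le_trans hs; apply: ler_wpM2l => //; exact: sqr_ge0.
Qed.

Lemma moment2_gt0 : prior [set a] = 0%E -> (0 < moment2)%E.
Proof.
move=> pa0; have ma := measurable_rV_set1 a.
have mf : measurable_fun setT (fun v : 'rV[R]_N => (eucl_norm (v - a) ^+ 2 * lik v)%:E).
  by apply/measurable_EFinP/measurable_funM => //; exact: measurable_funX.
have mC : measurable (~` [set a]) by exact: measurableC.
apply: (@lt_le_trans _ _ (\int[prior]_(v in ~` [set a])
    (eucl_norm (v - a) ^+ 2 * lik v)%:E)%E).
  apply: integral_gt0 => //.
  - exact: measurable_funTS.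
  - move=> v /= va; rewrite lte_fin mulr_gt0// exprn_gt0//.
    rewrite lt_neqAle eucl_norm_ge0 andbT eq_sym eucl_norm_eq0 subr_eq0.
    exact/eqP.
  - rewrite [X in X != _](probability_setC prior ma).
    by rewrite [X in (_ - X)%E]pa0 sube0 onee_neq0.
apply: ge0_subset_integral => //.
by move=> v _; rewrite lee_fin mulr_ge0 ?sqr_ge0// ltW.
Qed.

(** The radius is chosen so that, beyond half of it, A s <= (n c / 2) s^2, half of the decay given
    by [B_lower] when s <= 1; y e^(-y) <= 1 then yields 2 / (n c). For s > 1 only linear decay is
    available, and the hypothesis on the slope again spares half of it; t^2 e^(-t) <= 4 yields 16 /
    (n c)^2, which is at most 16 / (c^2 n). *)
Lemma moment2_le_good : (0 < n)%N -> slope <= n%:R * c / 2 ->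
  (moment2 <= ((4 * slope / (n%:R * c)) ^+ 2 +
    2 ^+ N * 4 * ((2 / c + 16 / c ^+ 2) / n%:R))%:E * mass)%E.
Proof.
move=> n0 An.
have n1 : 1 <= n%:R :> R by rewrite ler1n.
have nc0 : 0 < n%:R * c by rewrite mulr_gt0// ltr0n.
have c20 : 0 < c ^+ 2 by rewrite exprn_gt0.
apply: moment2_split.
- by rewrite divr_ge0 ?(ltW nc0)// mulr_ge0.
- by rewrite divr_ge0 ?ler0n// addr_ge0// divr_ge0// ltW.
move=> u; set s := eucl_norm u; rewrite ltr_pdivrMr// => hs.
have s0 : 0 <= s by exact: eucl_norm_ge0.
have hA : slope * s <= n%:R * c / 2 * s ^+ 2.
  have : slope * s <= (2 * s * (n%:R * c) / 4) * s by apply: ler_wpM2r => //; lra.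
  lra.
have hA1 : slope * s <= n%:R * c / 2 * s by exact: ler_wpM2r.
have nB : n%:R * c * Num.min (s ^+ 2) s <= n%:R * B u.
  by rewrite -mulrA ler_wpM2l// B_lower.
have ms0 : 0 <= m * s ^+ 2 by rewrite mulr_ge0 ?sqr_ge0// ltW.
have [s1|/ltW s1] := leP s 1.
  have mins : Num.min (s ^+ 2) s = s ^+ 2.
    by apply/min_idPl; rewrite expr2 ler_piMr.
  rewrite mins in nB.
  pose y := n%:R * c / 2 * s ^+ 2.
  have e1 : expR (slope * s - n%:R * B u - m * s ^+ 2) <= expR (- y).
    by rewrite ler_expR /y; lra.
  have e2 : y * expR (- y) <= 1.
    rewrite expRN ler_pdivrMr ?expR_gt0// mul1r.
    by have := expR_ge1Dx y; lra.
  apply: (@le_trans _ _ (2 / (n%:R * c) * (y * expR (- y)))).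
    rewrite [leRHS]mulrA (_ : 2 / (n%:R * c) * y = s ^+ 2).
      by apply: ler_wpM2l => //; exact: sqr_ge0.
    by rewrite /y; field; rewrite !gt_eqF// ltr0n.
  apply: (@le_trans _ _ (2 / (n%:R * c))).
    by rewrite ler_piMr// divr_ge0// ltW.
  rewrite (_ : 2 / (n%:R * c) = 2 / c / n%:R); last first.
    by field; rewrite !gt_eqF// ltr0n.
  by rewrite [leRHS]mulrDl lerDl divr_ge0 ?ler0n// divr_ge0// ltW.
have mins : Num.min (s ^+ 2) s = s.
  by apply/min_idPr; rewrite expr2 ler_peMr.
rewrite mins in nB.
pose t := n%:R * c / 2 * s.
have t0 : 0 <= t by rewrite mulr_ge0// divr_ge0// ltW.
have e1 : expR (slope * s - n%:R * B u - m * s ^+ 2) <= expR (- t).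
  by rewrite ler_expR /t; lra.
have e2 : t ^+ 2 * expR (- t) <= 4.
  rewrite expRN ler_pdivrMr ?expR_gt0//.
  have : (t / 2) ^+ 2 <= expR (t / 2) ^+ 2.
    rewrite lerXn2r ?nnegrE ?expR_ge0 ?divr_ge0//.
    by have := expR_ge1Dx (t / 2); lra.
  rewrite -expRM_natl (_ : 2%:R * (t / 2) = t); last by field.
  by rewrite expr_div_n (_ : 2 ^+ 2 = 4 :> R) 1?ler_pdivrMr// 1?mulrC//; ring.
apply: (@le_trans _ _ (4 / (n%:R * c) ^+ 2 * (t ^+ 2 * expR (- t)))).
  rewrite [leRHS]mulrA (_ : 4 / (n%:R * c) ^+ 2 * t ^+ 2 = s ^+ 2).
    by apply: ler_wpM2l => //; exact: sqr_ge0.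
  by rewrite /t; field; rewrite !gt_eqF// ltr0n.
apply: (@le_trans _ _ (4 / (n%:R * c) ^+ 2 * 4)).
  by apply: ler_wpM2l => //; rewrite divr_ge0// sqr_ge0.
rewrite [leRHS]mulrDl -[leLHS]add0r lerD// ?divr_ge0 ?ler0n// ?(ltW c0)//.
rewrite (_ : 4 / (n%:R * c) ^+ 2 * 4 = 16 / c ^+ 2 / n%:R * n%:R^-1); last first.
  by field; rewrite !gt_eqF// ltr0n.
by rewrite ler_piMr ?divr_ge0 ?ler0n ?(ltW c20)// invf_le1// ltr0n.
Qed.

(** The same argument with the prior's m s^2 in the role of the likelihood's decay: from the latter
    only [B] >= 0 is kept, so no restriction on [G] is required. *)
Lemma moment2_le_bad :
  (moment2 <= ((4 * slope / m) ^+ 2 + 2 ^+ N * 4 * (2 / m))%:E * mass)%E.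
Proof.
apply: moment2_split.
- by rewrite divr_ge0 ?(ltW m0)// mulr_ge0.
- by rewrite divr_ge0// ltW.
move=> u; set s := eucl_norm u; rewrite ltr_pdivrMr// => hs.
have s0 : 0 <= s by exact: eucl_norm_ge0.
have hA : slope * s <= m / 2 * s ^+ 2.
  have : slope * s <= (2 * s * m / 4) * s by apply: ler_wpM2r => //; lra.
  lra.
have nB : 0 <= n%:R * B u by rewrite mulr_ge0 ?ler0n.
pose y := m / 2 * s ^+ 2.
have e1 : expR (slope * s - n%:R * B u - m * s ^+ 2) <= expR (- y).
  by rewrite ler_expR /y; lra.
have e2 : y * expR (- y) <= 1.
  rewrite expRN ler_pdivrMr ?expR_gt0// mul1r.
  by have := expR_ge1Dx y; lra.
apply: (@le_trans _ _ (2 / m * (y * expR (- y)))).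
  rewrite [leRHS]mulrA (_ : 2 / m * y = s ^+ 2).
    by apply: ler_wpM2l => //; exact: sqr_ge0.
  by rewrite /y; field; rewrite gt_eqF.
by rewrite ler_piMr// divr_ge0// ltW.
Qed.

End posterior_moments.

(* Case distinction [Y q <= q ^ 2 c / 2] or not; in the second case
   [1 < (2 Y / (q c)) ^ 3] compensates the absence of decay in the second
   bound on [W]. *)
Lemma rate_combination (R : realType) (q Y W c m k1 k2 : R) :
  1 <= q -> 0 <= Y -> 0 < c -> 0 < m -> 0 <= k1 -> 0 <= k2 ->
  (Y * q <= q ^+ 2 * c / 2 -> W <= 4 * (Y * q) / (q ^+ 2 * c) + k1 / q) ->
  W <= 4 * (Y * q) / m + k2 ->
  W <= (4 / c + k1 + 32 / (m * c ^+ 3) + 8 * k2 / c ^+ 3) * (1 + Y ^+ 4) / q.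
Proof.
move=> q1 Y0 c0 m0 k10 k20 good bad.
have q0 : 0 < q by lra.
have Y4 : 0 <= Y ^+ 4 by rewrite exprn_ge0.
have YY : Y <= 1 + Y ^+ 4.
  have [Y1|/ltW Y1] := leP Y 1; first lra.
  by rewrite (@le_trans _ _ (Y ^+ 4)) ?lerDr// -[leLHS]expr1 ler_weXn2l.
have Y3 : Y ^+ 3 <= 1 + Y ^+ 4.
  have [Y1|/ltW Y1] := leP Y 1.
    by rewrite (@le_trans _ _ 1) ?lerDl// exprn_ile1.
  by rewrite (@le_trans _ _ (Y ^+ 4)) ?lerDr// ler_weXn2l.
have c30 : 0 < c ^+ 3 by rewrite exprn_gt0.
pose a1 := 4 / c; pose a3 := 32 / (m * c ^+ 3); pose a4 := 8 * k2 / c ^+ 3.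
have a10 : 0 <= a1 by rewrite divr_ge0// ltW.
have a30 : 0 <= a3 by rewrite divr_ge0// mulr_ge0 ?(ltW m0) ?(ltW c30).
have a40 : 0 <= a4 by rewrite divr_ge0 ?(ltW c30)// mulr_ge0.
rewrite ler_pdivlMr// -/a1 -/a3 -/a4.
have [h|h] := leP (Y * q) (q ^+ 2 * c / 2).
  apply: (@le_trans _ _ ((4 * (Y * q) / (q ^+ 2 * c) + k1 / q) * q)).
    by rewrite ler_pM2r// good.
  rewrite (_ : (4 * (Y * q) / (q ^+ 2 * c) + k1 / q) * q = a1 * Y + k1); last first.
    by rewrite /a1; field; rewrite !gt_eqF.
  have h1 : a1 * Y <= a1 * (1 + Y ^+ 4) by apply: ler_wpM2l.
  have h2 : 0 <= k1 * Y ^+ 4 by rewrite mulr_ge0.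
  have h3 : 0 <= (a3 + a4) * (1 + Y ^+ 4) by rewrite mulr_ge0 ?addr_ge0.
  lra.
(* With q = sqrt n and Y q the slope, failure of the first case makes z exceed 1. Its cube turns 4 Y
   q^2 / m into 32 Y^4 / (m c^3 q). *)
pose z := 2 * Y / (q * c).
have z1 : 1 <= z.
  rewrite /z ler_pdivlMr ?mulr_gt0// mul1r.
  have : q * c / 2 * q <= Y * q by lra.
  rewrite ler_pM2r//; lra.
have z3 : 1 <= z ^+ 3 by rewrite exprn_ege1.
have w0 : 0 <= (4 * (Y * q) / m + k2) * q.
  by rewrite mulr_ge0 ?(ltW q0)// addr_ge0// divr_ge0 ?(ltW m0)// !mulr_ge0// ltW.
apply: (@le_trans _ _ ((4 * (Y * q) / m + k2) * q)); first by rewrite ler_pM2r.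
apply: (@le_trans _ _ ((4 * (Y * q) / m + k2) * q * z ^+ 3)); first by rewrite ler_peMr.
rewrite (_ : (4 * (Y * q) / m + k2) * q * z ^+ 3 =
    a3 * Y ^+ 4 / q + a4 * Y ^+ 3 / q ^+ 2); last first.
  by rewrite /z /a3 /a4; field; rewrite !gt_eqF.
have h1 : a3 * Y ^+ 4 / q <= a3 * Y ^+ 4.
  by rewrite ler_pdivrMr// ler_peMr// mulr_ge0.
have h2 : a4 * Y ^+ 3 / q ^+ 2 <= a4 * Y ^+ 3.
  rewrite ler_pdivrMr ?exprn_gt0//; apply: ler_peMr; last exact: exprn_ege1.
  by rewrite mulr_ge0 ?exprn_ge0.
have h3 : a4 * Y ^+ 3 <= a4 * (1 + Y ^+ 4) by apply: ler_wpM2l.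
have h4 : 0 <= (a1 + k1) * (1 + Y ^+ 4) by rewrite mulr_ge0 ?addr_ge0.
have h5 : 0 <= a3 by [].
lra.
Qed.

(** Serves to construct a coupling of the posterior with a Dirac mass: the image, under v -> (v, a),
    of the prior weighted by the normalized likelihood. *)
Lemma image_density_probability d1 d2 (X : measurableType d1)
  (T : measurableType d2) (R : realType) (nu : {measure set X -> \bar R})
  (g : X -> T) (w : X -> R) :
  measurable_fun setT g -> measurable_fun setT w -> (forall x, 0 <= w x) ->
  (\int[nu]_x (w x)%:E = 1)%E ->
  exists mu : probability T R, forall A, measurable A ->
    mu A = (\int[nu]_(x in g @^-1` A) (w x)%:E)%E.
Proof.
move=> mg mw w0 w1.
pose dens (A : set X) : \bar R := (\int[nu]_(x in A) (w x)%:E)%E.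
have dens0 : dens set0 = 0%E by rewrite /dens integral_set0.
have dens_ge0 A : (0 <= dens A)%E.
  by apply: integral_ge0 => x _; rewrite lee_fin.
have dens_sigma : semi_sigma_additive dens.
  apply: semi_sigma_additive_nng_induced; first exact/measurable_EFinP.
  by move=> x; rewrite lee_fin.
pose m1 : {measure set X -> \bar R} :=
  HB.pack dens (isMeasure.Build _ _ _ dens dens0 dens_ge0 dens_sigma).
pose m2 : {measure set T -> \bar R} :=
  measure_function_pushforward__canonical__measure_function_Measure m1 mg.
have m2T : m2 setT = 1%E by rewrite /m2/= /pushforward preimage_setT.
pose p : probability T R := HB.pack (m2 : set T -> \bar R)
  (Measure.class m2) (Measure_isProbability.Build _ _ _ m2 m2T).
by exists p.
Qed.

(** * Wasserstein distance from the posterior to a Dirac mass *)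

Section likelihood_measurability.
Context {R : realType} {N : nat}.

Lemma measurable_dotv d (T : measurableType d) (u v : T -> 'rV[R]_N) :
  measurable_fun setT u -> measurable_fun setT v ->
  measurable_fun setT (fun t => dotv (u t) (v t)).
Proof.
move=> /measurable_fun_rVP mu /measurable_fun_rVP mv.
by apply: measurable_sum => i; exact: measurable_funM.
Qed.

Lemma measurable_sine_features :
  measurable_fun setT (sine_features : R -> 'rV[R]_N).
Proof.
apply/measurable_fun_rVP => i; apply: continuous_measurable_fun.
exact: continuous_sine_features.
Qed.

Lemma measurable_lg_partition : measurable_fun setT (fun theta : 'rV[R]_N =>
  int01 (fun x => expR (dotv theta (sine_features x)))).
Proof.
pose f (z : 'rV[R]_N * measurableTypeR R) : \bar R :=
  (expR (dotv z.1 (sine_features z.2)) * \1_(`[0, 1]%classic : set R) z.2)%:E.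
have mf : measurable_fun setT f.
  apply/measurable_EFinP; apply: measurable_funM.
    apply: measurableT_comp => //; apply: measurable_dotv; first exact: measurable_fst.
    exact: (measurableT_comp measurable_sine_features measurable_snd).
  apply: (measurableT_comp _ measurable_snd).
  exact: measurable_indic.
have f0 z : (0 <= f z)%E by rewrite lee_fin mulr_ge0 ?expR_ge0.
have := @measurable_fun_fubini_tonelli_F _ _ _ _ R
  (@lebesgue_measure R) f mf f0.
have mfine : measurable_fun setT (@fine R) by [].
move=> /(measurableT_comp mfine); apply: eq_measurable_fun => theta _.
rewrite /= /fubini_F /int01 /Rintegral; congr fine.
rewrite [RHS]integral_mkcond; apply: eq_integral => x _.
by rewrite restrict_EFin/= patchE /f/= indicE; case: ifP => _; rewrite ?mulr1 ?mulr0.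
Qed.

Lemma measurable_lg_density d (T : measurableType d) (u : T -> 'rV[R]_N) (x : T -> R) :
  measurable_fun setT u -> measurable_fun setT x ->
  measurable_fun setT (fun t => lg_density (u t) (x t)).
Proof.
move=> mu mx; apply: measurable_funM.
  apply: measurableT_comp => //; apply: measurable_dotv => //.
  exact: (measurableT_comp measurable_sine_features mx).
(* The partition function is positive, so its inverse is its power with exponent -1, a measurable
   function. *)
have mZ := measurableT_comp (measurable_powR (-1)) (measurableT_comp measurable_lg_partition mu).
apply: eq_measurable_fun mZ => t _ /=.
by rewrite powR_inv1// ltW// lg_partition_gt0.
Qed.

End likelihood_measurability.

Section wasserstein_posterior.
Context {R : realType} {N : nat}.
Variables (prior : probability 'rV[R]_N R) (xs : seq R) (a : 'rV[R]_N) (M V : R).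
Let lik : 'rV[R]_N -> R := likelihood xs.
Hypothesis lik_gt0 : forall v, 0 < lik v.
Hypothesis measurable_lik : measurable_fun setT lik.
Hypothesis M0 : 0 < M.
Hypothesis massE : mass prior lik = M%:E.
Hypothesis momentE : moment2 prior a lik = V%:E.

Let mElik : measurable_fun setT (EFin \o lik). Proof. exact/measurable_EFinP. Qed.

Let w v : R := M^-1 * lik v.

Let w_ge0 v : 0 <= w v. Proof. by rewrite mulr_ge0// ?invr_ge0 ltW. Qed.

Let measurable_w : measurable_fun setT w. Proof. exact: measurable_funM. Qed.

Lemma posteriorE A : measurable A ->
  posterior prior xs A = (\int[prior]_(v in A) (M^-1 * likelihood xs v)%:E)%E.
Proof.
move=> mA; rewrite /posterior [X in (_ / X)%E]massE inver (gt_eqF M0).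
under [RHS]eq_integral do rewrite EFinM.
rewrite ge0_integralZl//.
- by rewrite muleC.
- exact: measurable_funTS.
- by move=> v _; rewrite lee_fin ltW.
- by rewrite lee_fin invr_ge0 ltW.
Qed.

(** A coupling with a Dirac mass is concentrated where the second component is [a], so its cost
    depends on the first marginal alone. All couplings thus have the same cost. *)
Lemma integral_posterior_coupling
  (g : probability ('rV[R]_N * 'rV[R]_N)%type R) :
  couplings (posterior prior xs) (dirac a) g ->
  (\int[g]_z (eucl_norm (z.1 - z.2) ^+ 2)%:E = (V / M)%:E)%E.
Proof.
move=> gc; have ma := measurable_rV_set1 a.
pose f (v : 'rV[R]_N) : \bar R := (eucl_norm (v - a) ^+ 2)%:E.
have mf : measurable_fun setT f.
  by apply/measurable_EFinP/measurable_funX; exact: measurable_eucl_dist.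
have f0 v : (0 <= f v)%E by rewrite lee_fin sqr_ge0.
transitivity (\int[g]_z f z.1)%E.
  have mT : measurable ([set: 'rV[R]_N] `*` [set a]) by exact: measurableX.
  apply: ge0_ae_eq_integral => //.
  - apply/measurable_EFinP/measurable_funX.
    apply: (measurableT_comp (@measurable_eucl_norm R N)).
    apply/measurable_fun_rVP => i; under eq_fun do rewrite !mxE.
    apply: measurable_funB.
      exact: (measurableT_comp (@measurable_coord_rV R N i) measurable_fst).
    exact: (measurableT_comp (@measurable_coord_rV R N i) measurable_snd).
  - exact: (measurableT_comp mf measurable_fst).
  - by move=> z _; rewrite lee_fin sqr_ge0.
  - exists (~` ([set: 'rV[R]_N] `*` [set a])); split.
    + exact: measurableC.
    + apply: (etrans (probability_setC g mT)).
      by rewrite (gc _ ma).2 diracE mem_set// subee.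
    + move=> z /= h [_ za]; apply: h => _.
      by rewrite /f za.
transitivity (\int[prior]_v (f v * (w v)%:E))%E.
  transitivity (\int[g]_z (f z.1 * (cst 1 z)%:E))%E.
    by apply: eq_integral => z _; rewrite mule1.
  apply: (@eq_integral_transfer _ _ _ _ _ _ _ g prior fst id (cst 1) w f) => //.
  move=> A mA.
  have mA' : measurable ((@fst 'rV[R]_N 'rV[R]_N) @^-1` A).
    by apply: measurable_preimageT => //; exact: measurable_fst.
  rewrite [LHS](integral_cst g mA' 1%:E) mul1e.
  have -> : fst @^-1` A = A `*` [set: 'rV[R]_N].
    by apply/seteqP; split => [[x y]|[x y] []].
  by apply: (etrans (gc _ mA).1); rewrite posteriorE.
transitivity ((M^-1)%:E * \int[prior]_v (eucl_norm (v - a) ^+ 2 * lik v)%:E)%E.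
  rewrite -ge0_integralZl//.
  - by apply: eq_integral => v _; rewrite /f -!EFinM /w mulrCA.
  - apply/measurable_EFinP/measurable_funM => //; apply: measurable_funX.
    exact: measurable_eucl_dist.
  - by move=> v _; rewrite lee_fin mulr_ge0 ?sqr_ge0// ltW.
  - by rewrite lee_fin invr_ge0 ltW.
by rewrite [X in (_ * X)%E]momentE -EFinM mulrC.
Qed.

(** Needed because the infimum over an empty set of couplings would be [+oo]. *)
Lemma posterior_coupling_exists :
  exists g, couplings (posterior prior xs) (dirac a) g.
Proof.
have mj : measurable_fun setT (fun v : 'rV[R]_N => (v, a)).
  exact: measurable_fun_pair.
have w1 : (\int[prior]_v (w v)%:E = 1)%E.
  rewrite -(posteriorE measurableT) /posterior [X in (X / _)%E]massE.
  by rewrite [X in (_ / X)%E]massE inver (gt_eqF M0) -EFinM mulfV ?gt_eqF.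
have [g gE] := image_density_probability mj measurable_w w_ge0 w1.
exists g => A mA; split.
  rewrite gE; last exact: measurableX.
  rewrite posteriorE//; congr (integral _ _ _).
  by apply/seteqP; split => [v []|v].
rewrite gE; last exact: measurableX.
have [Aa|Aa] := pselect (A a).
  rewrite (_ : _ @^-1` _ = setT); last by apply/seteqP; split.
  by rewrite w1 diracE mem_set.
rewrite (_ : _ @^-1` _ = set0); last by apply/seteqP; split => [v []|].
by rewrite integral_set0 diracE memNset.
Qed.

Lemma wasserstein2_posterior_dirac :
  wasserstein2 (posterior prior xs) (dirac a) = (Num.sqrt (V / M))%:E.
Proof.
rewrite /wasserstein2; set S := [set _ | _ in _].
suff -> : S = [set (V / M)%:E] by rewrite ereal_inf1.
apply/seteqP; split => [_ [g gc <-]|_ ->]; first exact: integral_posterior_coupling.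
have [g gc] := posterior_coupling_exists.
by exists g => //; exact: integral_posterior_coupling.
Qed.

End wasserstein_posterior.

Lemma markov_measure d (T : measurableType d) (R : realType)
  (mu : {measure set T -> \bar R}) (f : T -> R) (D : set T) (t : R) :
  measurable_fun setT f -> (forall x, 0 <= f x) -> measurable D -> 0 <= t ->
  (forall x, D x -> t <= f x) ->
  (t%:E * mu D <= \int[mu]_x (f x)%:E)%E.
Proof.
move=> mf f0 mD t0 tf; rewrite -(integral_cst mu mD t%:E).
have mEf : measurable_fun setT (EFin \o f) by exact/measurable_EFinP.
apply: (@le_trans _ _ (\int[mu]_(x in D) (f x)%:E)%E).
  by apply: ge0_le_integral => //; exact: measurable_funTS.
by apply: ge0_subset_integral => // x _; rewrite lee_fin.
Qed.

Lemma add_expr4_le (R : realType) (x y : R) :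
  (x + y) ^+ 4 <= 8 * (x ^+ 4 + y ^+ 4).
Proof.
have h1 : (x + y) ^+ 2 <= 2 * (x ^+ 2 + y ^+ 2).
  by have := sqr_ge0 (x - y); lra.
have h2 : (x ^+ 2 + y ^+ 2) ^+ 2 <= 2 * (x ^+ 4 + y ^+ 4).
  by have := sqr_ge0 (x ^+ 2 - y ^+ 2); lra.
have h3 : ((x + y) ^+ 2) ^+ 2 <= (2 * (x ^+ 2 + y ^+ 2)) ^+ 2.
  have h0 := sqr_ge0 (x + y); have h00 := le_trans h0 h1.
  by rewrite lerXn2r.
rewrite -exprM in h3; lra.
Qed.

Lemma sum_expr4_le (R : realType) (I : Type) (r : seq I) (f : I -> R) :
  (\sum_(i <- r) f i) ^+ 4 <= 8 ^+ size r * \sum_(i <- r) f i ^+ 4.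
Proof.
elim: r => [|i r IH]; first by rewrite !big_nil expr0n/= mulr0.
rewrite !big_cons /= [8 ^+ _]exprS.
set s := \sum_(j <- r) f j in IH *; set S := \sum_(j <- r) _ in IH *.
apply: le_trans (add_expr4_le _ _) _; rewrite -mulrA ler_pM2l// mulrDr lerD//.
by rewrite ler_peMl ?exprn_even_ge0// exprn_ege1// ler1n.
Qed.

Lemma sqrt_div_le (R : realType) (V M a b : R) : 0 < M -> 0 <= a -> 0 <= b ->
  V <= (a ^+ 2 + b) * M -> Num.sqrt (V / M) <= a + Num.sqrt b.
Proof.
move=> M0 a0 b0 h; have sb := sqrtr_ge0 b.
apply: (@le_trans _ _ (Num.sqrt ((a + Num.sqrt b) ^+ 2))); last first.
  by rewrite sqrtr_sqr ger0_norm// addr_ge0.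
apply: ler_wsqrtr; rewrite ler_pdivrMr//; apply: le_trans h _.
rewrite ler_pM2r// sqrrD sqr_sqrtr// -addrA lerD2l lerDr mulrn_wge0// mulr_ge0//.
Qed.

Local Opaque lg_density bregman sine_mean.

Section likelihood_theory.
Context {R : realType} {N : nat}.
Implicit Types (theta h : 'rV[R]_N) (xs : seq R).

Lemma likelihood_gt0 xs theta : 0 < likelihood xs theta.
Proof. by rewrite prodr_gt0// => x _; exact: lg_density_gt0. Qed.

Lemma likelihood_nil theta : likelihood [::] theta = 1.
Proof. exact: big_nil. Qed.

Lemma likelihood_cons x xs theta :
  likelihood (x :: xs) theta = lg_density theta x * likelihood xs theta.
Proof. exact: big_cons. Qed.

Lemma likelihoodD theta xs h :
  likelihood xs (theta + h) = likelihood xs theta *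
    expR (dotv h (\sum_(x <- xs) (sine_features x - sine_mean theta)) -
          (size xs)%:R * bregman theta h).
Proof.
elim: xs => [|x xs IH].
  have -> : dotv h (\sum_(x <- [::]) (sine_features x - sine_mean theta)) = 0.
    by rewrite big_nil /dotv big1// => i _; rewrite mxE mulr0.
  by rewrite !likelihood_nil mul0r subr0 expR0 mul1r.
rewrite !likelihood_cons IH lg_densityD mulrACA -expRD; congr (_ * expR _).
rewrite big_cons dotvDr -/(centered theta h x).
rewrite (_ : (size (x :: xs))%:R = (size xs)%:R + 1 :> R); last by rewrite /= -natr1.
move: (bregman _ _) (centered _ _ _) (dotv _ _) => b y z; ring.
Qed.

Lemma measurable_likelihood d (T : measurableType d) (u : T -> 'rV[R]_N)
  (xi : nat -> T -> R) n :
  measurable_fun setT u -> (forall i, measurable_fun setT (xi i)) ->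
  measurable_fun setT (fun t => likelihood [seq xi i t | i <- iota 0 n] (u t)).
Proof.
move=> mu mxi; rewrite /likelihood; under eq_fun do rewrite big_map.
by apply: measurable_prod => i _; exact: measurable_lg_density.
Qed.

End likelihood_theory.

(** * Contraction *)

Section contraction.
Context {R : realType} {N : nat}.
Variables (U : 'rV[R]_N -> R) (prior : probability 'rV[R]_N R).
Hypotheses (cU : continuous U) (Uconv : strongly_convex U).
Hypothesis hprior : has_density_propto_exp prior U.
Variable theta0 : 'rV[R]_N.
Context {d : measure_display} {Omega : measurableType d}.
Variables (P : probability Omega R) (xi : nat -> {RV P >-> R}).
Hypothesis hxi : iid_lg theta0 xi.

Let sample n w : seq R := [seq xi i w | i <- iota 0 n].

Let lik n w : 'rV[R]_N -> R := likelihood (sample n w).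

Let G n w : 'rV[R]_N := \row_k deviation theta0 xi n w k.

Let likD n w h : lik n w (theta0 + h) =
  lik n w theta0 * expR (dotv h (G n w) - n%:R * bregman theta0 h).
Proof.
have GE : \sum_(x <- sample n w) (sine_features x - sine_mean theta0) = G n w.
  apply/rowP => k; rewrite mxE summxE /deviation big_map -[n in iota 0 n]subn0.
  rewrite -/(index_iota 0 n) big_mkord.
  by apply: eq_bigr => i _; rewrite mxE [X in _ + X]mxE.
by have := likelihoodD theta0 (sample n w) h; rewrite GE size_map size_iota.
Qed.

Let measurable_lik n w : measurable_fun setT (lik n w).
Proof. exact: (@measurable_likelihood _ _ _ _ id (fun i _ => xi i w)). Qed.

Let measurable_lik2 n :
  measurable_fun setT (fun z : 'rV[R]_N * Omega => lik n z.2 z.1).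
Proof.
apply: (@measurable_likelihood _ _ _ _ fst (fun i z => xi i z.2)).
  exact: measurable_fst.
by move=> i; exact: (measurableT_comp (@measurable_funPT _ _ _ _ (xi i)) measurable_snd).
Qed.

Let B_double h : 2 * bregman theta0 h <= bregman theta0 (2 *: h).
Proof. by apply: bregmanZ; rewrite ler1n. Qed.

Definition post_mass n w : R := fine (mass prior (lik n w)).

Definition post_moment n w : R := fine (moment2 prior theta0 (lik n w)).

Definition post_risk n w : R := Num.sqrt (post_moment n w / post_mass n w).

(** Tonelli's theorem for the likelihood as a jointly measurable function of the parameter and the
    outcome; it makes all posterior quantities random variables. *)
Let measurable_prior_integral (A : set 'rV[R]_N) (f : 'rV[R]_N -> R) n :
  measurable A -> measurable_fun setT f -> (forall v, 0 <= f v) ->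
  measurable_fun setT (fun w => fine (\int[prior]_(v in A) (f v * lik n w v)%:E)%E).
Proof.
move=> mA mf f0.
pose F (z : 'rV[R]_N * Omega) : \bar R := (\1_A z.1 * f z.1 * lik n z.2 z.1)%:E.
have mF : measurable_fun setT F.
  apply/measurable_EFinP; apply: measurable_funM => //; apply: measurable_funM.
    by apply: (measurableT_comp _ measurable_fst); exact: measurable_indic.
  exact: (measurableT_comp mf measurable_fst).
have F0 z : (0 <= F z)%E.
  by rewrite lee_fin !mulr_ge0// ltW// likelihood_gt0.
have mfine : measurable_fun setT (@fine R) by [].
have := @measurable_fun_fubini_tonelli_G _ _ _ _ R prior F mF F0.
move=> /(measurableT_comp mfine); apply: eq_measurable_fun => w _.
rewrite /= /fubini_G; congr fine; rewrite [RHS]integral_mkcond.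
apply: eq_integral => v _; rewrite restrict_EFin/= patchE /F/= indicE.
by case: ifP => _; rewrite ?mul1r ?mul0r.
Qed.

Let measurable_post_mass n : measurable_fun setT (post_mass n).
Proof.
have := @measurable_prior_integral setT (cst 1) n measurableT (measurable_cst _) (fun=> ler01).
apply: eq_measurable_fun => w _; rewrite /post_mass; congr fine.
by apply: eq_integral => v _; rewrite mul1r.
Qed.

Let measurable_post_moment n : measurable_fun setT (post_moment n).
Proof.
apply: (@measurable_prior_integral setT (fun v => eucl_norm (v - theta0) ^+ 2)) => //.
  by apply: measurable_funX; exact: measurable_eucl_dist.
by move=> v; exact: sqr_ge0.
Qed.

Let bounds : exists L m c : R, [/\ 0 <= L, 0 < m, 0 < c &
  forall n w,
  [/\ mass prior (lik n w) = (post_mass n w)%:E,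
      moment2 prior theta0 (lik n w) = (post_moment n w)%:E,
      0 < post_mass n w,
      (0 < n)%N -> slope L (G n w) <= n%:R * c / 2 ->
        post_moment n w <= ((4 * slope L (G n w) / (n%:R * c)) ^+ 2 +
          2 ^+ N * 4 * ((2 / c + 16 / c ^+ 2) / n%:R)) * post_mass n w &
      post_moment n w <= ((4 * slope L (G n w) / m) ^+ 2 +
          2 ^+ N * 4 * (2 / m)) * post_mass n w]].
Proof.
have [L [m [L0 m0 doubling]]] := prior_doubling theta0 cU Uconv hprior.
have [c c0 B_lower] := bregman_lower theta0.
exists L, m, c; split => // n w.
have lik0 := @likelihood_gt0 R N (sample n w).
have M0 := mass_gt0 prior lik0 (measurable_lik n w).
have Moo := mass_lty L0 m0 c0 doubling B_lower lik0 (measurable_lik n w) (likD n w).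
have ME : mass prior (lik n w) = (post_mass n w)%:E.
  by rewrite fineK// ge0_fin_numE// ltW.
have bad := moment2_le_bad L0 m0 c0 doubling B_lower B_double lik0
  (measurable_lik n w) (likD n w).
have V0 : (0 <= moment2 prior theta0 (lik n w))%E.
  apply: integral_ge0 => v _; rewrite lee_fin.
  by apply: mulr_ge0; [exact: sqr_ge0|exact: ltW (lik0 v)].
have VE : moment2 prior theta0 (lik n w) = (post_moment n w)%:E.
  by rewrite fineK// ge0_fin_numE// (le_lt_trans bad)// ME -EFinM ltry.
split => //.
- by rewrite -lte_fin -ME.
- move=> n0 sn.
  have := moment2_le_good L0 m0 c0 doubling B_lower B_double lik0
    (measurable_lik n w) (likD n w) n0 sn.
  by rewrite ME VE -EFinM lee_fin.
- by move: bad; rewrite ME VE -EFinM lee_fin.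
Qed.

Let massE n w : mass prior (lik n w) = (post_mass n w)%:E.
Proof. by have [L [m [c [_ _ _ /(_ n w)[]]]]] := bounds. Qed.

Let momentE n w : moment2 prior theta0 (lik n w) = (post_moment n w)%:E.
Proof. by have [L [m [c [_ _ _ /(_ n w)[]]]]] := bounds. Qed.

Let post_mass_gt0 n w : 0 < post_mass n w.
Proof. by have [L [m [c [_ _ _ /(_ n w)[]]]]] := bounds. Qed.

Lemma wasserstein2_post_risk n w :
  wasserstein2 (posterior_at prior xi n w) (dirac theta0) = (post_risk n w)%:E.
Proof.
apply: (wasserstein2_posterior_dirac _ (measurable_lik n w) (post_mass_gt0 n w)
  (massE n w) (momentE n w)).
exact: likelihood_gt0.
Qed.

Let measurable_inv_mass n : measurable_fun setT (fun w => (post_mass n w)^-1).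
Proof.
have := measurableT_comp (measurable_powR (-1)) (measurable_post_mass n).
by apply: eq_measurable_fun => w _; rewrite /= powR_inv1// ltW.
Qed.

Lemma measurable_post_risk n : measurable_fun setT (post_risk n).
Proof.
apply: (measurableT_comp (@measurable_sqrtr R)).
exact: measurable_funM.
Qed.

Lemma post_risk_ge0 n w : 0 <= post_risk n w. Proof. exact: sqrtr_ge0. Qed.

(** The prior does not charge [theta0], so the squared distance is positive almost everywhere. For N
    = 0 the parameter space is one point and the risk vanishes. *)
Lemma post_risk_gt0 n w : (0 < N)%N -> 0 < post_risk n w.
Proof.
move=> N0; rewrite sqrtr_gt0 divr_gt0// -lte_fin -momentE.
apply: moment2_gt0 => //; first exact: likelihood_gt0.
have [c c0 ->] := hprior; last exact: measurable_rV_set1.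
rewrite (_ : \int[_]_(_ in _) _ = 0)%E ?mule0//.
apply: null_set_integral; first exact: measurable_rV_set1.
- apply/measurable_EFinP/measurable_funTS/measurableT_comp => //.
  by apply: measurable_funN; exact: continuous_measurable_rV.
- exact: lebesgue_rV_set1.
Qed.

Lemma post_risk_le : exists2 C : R, 0 <= C & forall n w, (0 < n)%N ->
  post_risk n w <= C / Num.sqrt n%:R *
    (1 + \sum_k (deviation theta0 xi n w k / Num.sqrt n%:R) ^+ 4).
Proof.
have [L [m [c [L0 m0 c0 H]]]] := bounds.
pose K1 := 2 ^+ N * 4 * (2 / c + 16 / c ^+ 2) : R.
pose K2 := 2 ^+ N * 4 * (2 / m) : R.
have K10 : 0 <= K1.
  apply: mulr_ge0; first by rewrite mulr_ge0// exprn_ge0.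
  by rewrite addr_ge0// divr_ge0 ?sqr_ge0// ltW.
have K20 : 0 <= K2.
  by apply: mulr_ge0; [rewrite mulr_ge0// exprn_ge0|rewrite divr_ge0// ltW].
pose C0 := 4 / c + Num.sqrt K1 + 32 / (m * c ^+ 3) + 8 * Num.sqrt K2 / c ^+ 3.
have c30 : 0 < c ^+ 3 by rewrite exprn_gt0.
have C00 : 0 <= C0.
  have h1 : 0 <= 4 / c by rewrite divr_ge0// ltW.
  have h2 : 0 <= 32 / (m * c ^+ 3) by rewrite divr_ge0// mulr_ge0// ltW.
  have h3 : 0 <= 8 * Num.sqrt K2 / c ^+ 3.
    by rewrite divr_ge0 ?(ltW c30)// mulr_ge0// sqrtr_ge0.
  by rewrite /C0 !addr_ge0// sqrtr_ge0.
pose e : R := 8 ^+ size (index_enum 'I_N).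
have e0 : 0 <= e by rewrite exprn_ge0.
(* Chosen so that 1 + Y^4 <= C1 (1 + S) follows from Y^4 <= 8 (L^4 + e S) below. *)
pose C1 := 1 + 8 * L ^+ 4 + 8 * e.
have L40 : 0 <= L ^+ 4 by rewrite exprn_ge0.
exists (C0 * C1); first by rewrite mulr_ge0// !addr_ge0// mulr_ge0.
move=> n w n0; set q := Num.sqrt n%:R.
have [_ _ M0 good bad] := H n w.
have q2 : q ^+ 2 = n%:R by rewrite sqr_sqrtr// ler0n.
have q1 : 1 <= q by rewrite -[leLHS]sqrtr1 ler_wsqrtr// ler1n.
have q0 : 0 < q by exact: lt_le_trans q1.
set S := \sum_k _.
have S0 : 0 <= S by apply: sumr_ge0 => k _; rewrite exprn_even_ge0.
pose Y := slope L (G n w) / q.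
have Yq : Y * q = slope L (G n w) by rewrite /Y divfK// gt_eqF.
have sl0 : 0 <= slope L (G n w) by rewrite addr_ge0// sumr_ge0.
have Y0 : 0 <= Y by rewrite divr_ge0// ltW.
have Y4 : Y ^+ 4 <= 8 * (L ^+ 4 + e * S).
  have YE : Y = L / q + \sum_k `|deviation theta0 xi n w k / q|.
    rewrite /Y /slope mulrDl mulr_suml; congr (_ + _); apply: eq_bigr => k _.
    by rewrite mxE normrM (ger0_norm (_ : 0 <= q^-1))// invr_ge0 ltW.
  rewrite YE; apply: le_trans (add_expr4_le _ _) _.
  rewrite ler_pM2l// lerD//.
    rewrite lerXn2r ?nnegrE ?divr_ge0 ?(ltW q0)//.
    by rewrite ler_pdivrMr// ler_peMr.
  apply: le_trans (sum_expr4_le _ _) _.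
  rewrite ler_wpM2l//; apply: ler_sum => k _.
  by rewrite -normrX ger0_norm// exprn_even_ge0.
have main : post_risk n w <= C0 * (1 + Y ^+ 4) / q.
  apply: rate_combination => //; try exact: sqrtr_ge0.
  - rewrite Yq q2 => sn; have := good n0 sn => {}good.
    have -> : Num.sqrt K1 / q = Num.sqrt (K1 / n%:R).
      by rewrite (sqrtrM _ K10) sqrtrV// ler0n.
    apply: sqrt_div_le => //.
    + by rewrite divr_ge0 ?mulr_ge0 ?ler0n// ltW.
    + by rewrite divr_ge0.
    + have -> : K1 / n%:R = 2 ^+ N * 4 * ((2 / c + 16 / c ^+ 2) / n%:R).
        exact: esym (mulrA _ _ _).
      exact: good.
  - rewrite Yq; apply: sqrt_div_le => //.
    by rewrite divr_ge0 ?(ltW m0)// mulr_ge0.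
apply: le_trans main _; rewrite mulrAC -(mulrA C0) (mulrAC C0) -(mulrA C0).
rewrite -!mulrA; apply: ler_wpM2l => //.
rewrite mulrCA [leRHS]mulrCA; apply: ler_wpM2l; first by rewrite invr_ge0 ltW.
have h1 : 0 <= (8 * L ^+ 4) * S by rewrite !mulr_ge0.
rewrite /C1; lra.
Qed.

Lemma wasserstein_rateE n :
  wasserstein_rate prior xi theta0 n = (\int[P]_w (post_risk n w)%:E)%E.
Proof. by apply: eq_integral => w _; exact: wasserstein2_post_risk. Qed.

Lemma wasserstein_rate_le : exists2 C : R, 0 <= C & forall n, (0 < n)%N ->
  (wasserstein_rate prior xi theta0 n <= (C / Num.sqrt n%:R)%:E)%E.
Proof.
have [C C0 risk_le] := post_risk_le.
have [K K0 moment_le] := deviation_fourth_moment hxi.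
exists (C * (1 + \sum_(k < N) K)).
  by rewrite mulr_ge0// addr_ge0// sumr_ge0.
move=> n n0; set q := Num.sqrt n%:R.
have q0 : 0 < q by rewrite sqrtr_gt0 ltr0n.
pose D w k := (deviation theta0 xi n w k / q) ^+ 4.
have D0 w k : 0 <= D w k by rewrite exprn_even_ge0.
have mD k : measurable_fun setT (fun w => D w k).
  by apply: measurable_funX; apply: measurable_funM => //; exact: measurable_deviation.
have mED k : measurable_fun setT (fun w => (D w k)%:E) by exact/measurable_EFinP.
have mS : measurable_fun setT (fun w => \sum_(k < N) (D w k)%:E)%E.
  exact: emeasurable_sum.
have S0 w : (0 <= \sum_(k < N) (D w k)%:E)%E by apply: sume_ge0 => k _; rewrite lee_fin.
have Cq0 : 0 <= C / q by rewrite divr_ge0// ltW.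
rewrite wasserstein_rateE.
apply: (@le_trans _ _ (\int[P]_w ((C / q)%:E * (1 + \sum_(k < N) (D w k)%:E)))%E).
  apply: ge0_le_integral => //.
  - by move=> w _; rewrite lee_fin post_risk_ge0.
  - by apply/measurable_EFinP; exact: measurable_post_risk.
  - by apply: measurable_funeM; apply: emeasurable_funD.
  - by move=> w _; rewrite sumEFin -EFinD -EFinM lee_fin risk_le.
rewrite ge0_integralZl//; last 2 first.
- exact: emeasurable_funD.
- by move=> w _; rewrite adde_ge0.
have P1 : (\int[P]_w (1 : \bar R) = 1)%E.
  apply: (etrans (integral_cst P measurableT 1%E)); rewrite mul1e.
  exact: probability_setT.
rewrite ge0_integralD// P1.
rewrite ge0_integral_sum//; last by move=> k w _; rewrite lee_fin.
rewrite mulrAC [leRHS]EFinM; apply: lee_wpmul2l; first by rewrite lee_fin.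
by rewrite EFinD leeD// -sumEFin; apply: lee_sum => k _; exact: moment_le.
Qed.

(** Markov's inequality twice. Under the posterior, mass at least delta outside the ball of radius t
    forces the second moment to be at least delta t^2, hence the risk to be at least sqrt(delta) t;
    under [P], this event is then controlled by the mean risk. *)
Lemma posterior_tail_le n (t delta : R) : 0 < t -> 0 < delta ->
  ((Num.sqrt delta * t)%:E * P [set w | (delta%:E <= posterior_at prior xi n w
     [set theta | (t <= eucl_norm (theta - theta0))%R])%E] <=
   wasserstein_rate prior xi theta0 n)%E.
Proof.
move=> t0 d0.
pose A : set 'rV[R]_N := [set theta | t <= eucl_norm (theta - theta0)].
rewrite -/A.
have mA : measurable A.
  have -> : A = (fun v : 'rV[R]_N => eucl_norm (v - theta0)) @^-1` `[t, +oo[.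
    by apply/seteqP; split => v /=; rewrite in_itv/= andbT.
  by apply: measurable_preimageT => //; exact: measurable_eucl_dist.
pose I w : R := fine (\int[prior]_(v in A) (cst 1 v * lik n w v)%:E)%E.
have mI : measurable_fun setT I.
  exact: (@measurable_prior_integral A (cst 1) n mA (measurable_cst _) (fun=> ler01)).
have lik0 w v : 0 < lik n w v by exact: likelihood_gt0.
have mElik w : measurable_fun setT (fun v => (lik n w v)%:E) by exact/measurable_EFinP.
have IE w : (\int[prior]_(v in A) (lik n w v)%:E = (I w)%:E)%E.
  rewrite /I; under [in RHS]eq_integral do rewrite /= mul1r.
  rewrite fineK// ge0_fin_numE; last first.
    by apply: integral_ge0 => v _; rewrite lee_fin ltW.
  apply: (@le_lt_trans _ _ (mass prior (lik n w))); last by rewrite massE ltry.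
  by apply: ge0_subset_integral => // v _; rewrite lee_fin ltW.
have postE w : posterior_at prior xi n w A = (I w / post_mass n w)%:E.
  rewrite /posterior_at /posterior [X in (X / _)%E](IE w).
  by rewrite [X in (_ / X)%E](massE n w) inver (gt_eqF (post_mass_gt0 n w)).
have mE : measurable [set w | (delta%:E <= posterior_at prior xi n w A)%E].
  have -> : [set w | (delta%:E <= posterior_at prior xi n w A)%E] =
      (fun w => I w / post_mass n w) @^-1` `[delta, +oo[.
    by apply/seteqP; split => w /=; rewrite postE lee_fin in_itv/= andbT.
  apply: measurable_preimageT => //.
  exact: measurable_funM.
rewrite wasserstein_rateE; apply: markov_measure => //.
- exact: measurable_post_risk.
- by move=> w; exact: post_risk_ge0.
- by rewrite mulr_ge0 ?sqrtr_ge0// ltW.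
move=> w /=; rewrite postE lee_fin => dI.
have tI : t ^+ 2 * I w <= post_moment n w.
  rewrite -lee_fin -momentE EFinM -IE -ge0_integralZl//.
  - apply: (@le_trans _ _ (\int[prior]_(v in A)
        (eucl_norm (v - theta0) ^+ 2 * lik n w v)%:E)%E).
      apply: ge0_le_integral => //.
      + by move=> v _; rewrite mule_ge0// lee_fin ?sqr_ge0// ltW.
      + by apply: measurable_funeM; exact: measurable_funTS.
      + apply/measurable_EFinP/measurable_funTS/measurable_funM => //.
        by apply: measurable_funX; exact: measurable_eucl_dist.
      + move=> v /= tv; rewrite -EFinM lee_fin ler_wpM2r ?(ltW (lik0 _ _))//.
        by rewrite lerXn2r ?nnegrE ?(ltW t0)// eucl_norm_ge0.
    apply: ge0_subset_integral => //.
    + apply/measurable_EFinP/measurable_funM => //.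
      by apply: measurable_funX; exact: measurable_eucl_dist.
    + by move=> v _; rewrite lee_fin mulr_ge0 ?sqr_ge0// ltW.
  - exact: measurable_funTS.
  - by move=> v _; rewrite lee_fin ltW.
  - by rewrite lee_fin sqr_ge0.
rewrite -[t in _ * t](ger0_norm (ltW t0)) -sqrtr_sqr -sqrtrM ?(ltW d0)//.
apply: ler_wsqrtr; rewrite ler_pdivlMr//.
apply: le_trans tI; rewrite mulrAC mulrC ler_wpM2l ?sqr_ge0//.
by rewrite -ler_pdivlMr.
Qed.

End contraction.

Unset Implicit Arguments.

Theorem proposition4p4 (R : realType) (N : nat) (hN : (0 < N)%N)
  (U : 'rV[R]_N -> R) (hU : class_C2 U) (hUconv : strongly_convex U)
  (prior : probability 'rV[R]_N R) (hprior : has_density_propto_exp prior U)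
  (theta0 : 'rV[R]_N)
  (d : measure_display) (Omega : measurableType d) (P : probability Omega R)
  (xi : nat -> {RV P >-> R}) (hxi : iid_lg theta0 xi) :
  let eps : nat -> \bar R := wasserstein_rate prior xi theta0 in
  (forall n : nat, (0 < n)%N -> eps n \is a fin_num) /\
  is_PCR prior xi theta0 (fun n => fine (eps n)) /\
  (fun n => fine (eps n) : R^o) =O_\oo (fun n => (Num.sqrt n%:R)^-1 : R^o).
Proof.
move=> eps.
have cU : continuous U by have [[]] := hU.
have [C C0 eps_le] := wasserstein_rate_le cU hUconv hprior hxi.
have epsE := @wasserstein_rateE R N U prior cU hUconv hprior theta0 d Omega P xi.
have mrisk := @measurable_post_risk R N U prior cU hUconv hprior theta0 d Omega P xi.
(* Positivity is part of [is_PCR], and it allows division by the rate in the contraction bound. *)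
have eps_gt0 n : (0 < eps n)%E.
  rewrite /eps epsE; apply: integral_gt0 => //; first exact/measurable_EFinP.
  - by move=> w _; rewrite lte_fin; exact: (post_risk_gt0 cU hUconv hprior).
  - by rewrite [X in X != _]probability_setT onee_neq0.
have eps_fin n : (0 < n)%N -> eps n \is a fin_num.
  move=> n0; rewrite ge0_fin_numE ?ltW//.
  exact: le_lt_trans (eps_le n n0) (ltry _).
have fine_gt0 n : (0 < n)%N -> 0 < fine (eps n).
  by move=> n0; rewrite -lte_fin fineK ?eps_fin.
split => //; split; first split => //.
- move=> M M0 Moo delta d0.
  have sd0 : 0 < Num.sqrt delta by rewrite sqrtr_gt0.
  (* At radius M_n eps_n the rate cancels from [posterior_tail_le], leaving 1 / (sqrt(delta) M_n),
     which tends to zero. *)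
  apply: (@squeeze_cvge _ _ _ _ (cst 0%E) _ (fun n => ((Num.sqrt delta * M n)^-1)%:E)).
  + near=> n.
    rewrite measure_ge0/=.
    have n0 : (0 < n)%N by near: n; exact: nbhs_infty_gt.
    have e0 := fine_gt0 n n0.
    have tail := posterior_tail_le cU hUconv hprior theta0 xi n (mulr_gt0 (M0 n) e0) d0.
    have sMe : 0 < Num.sqrt delta * (M n * fine (eps n)) by rewrite !mulr_gt0.
    move: tail; rewrite -lee_pdivlMl// => tail.
    apply: (@le_trans _ _ ((Num.sqrt delta * (M n * fine (eps n)))^-1%:E * eps n)%E).
      exact: tail.
    rewrite -[X in (_ * X)%E](fineK (eps_fin n n0)) -EFinM lee_fin.
    by rewrite mulrA invfM divfK// gt_eqF.
  + exact: cvg_cst.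
  + apply: cvg_EFin; first exact: nearW.
    apply/(@gtr0_cvgV0 R _ _ _ (fun n => Num.sqrt delta * M n)).
      by apply: nearW => n; rewrite mulr_gt0.
    apply/cvgryPge => A; move/cvgryPge: Moo => /(_ (A / Num.sqrt delta)).
    by apply: filterS => n; rewrite ler_pdivrMr// mulrC.
- apply/eqOP; near=> k; near=> n.
  have n0 : (0 < n)%N by near: n; exact: nbhs_infty_gt.
  rewrite ger0_norm ?(ltW (fine_gt0 n n0))// ger0_norm ?invr_ge0 ?sqrtr_ge0//.
  apply: (@le_trans _ _ (C / Num.sqrt n%:R)).
    by rewrite -lee_fin fineK ?eps_fin// eps_le.
  rewrite ler_wpM2r ?invr_ge0 ?sqrtr_ge0//.
Unshelve. all: by end_near.
Qed.
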